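(* Let $V$ be an uncountable Gödel set in which $0$ is an isolated point. Let $\Gamma$ be a set of closed formulas and $A$ a formula. Then $\Gamma\models_V A$ if and only if $\Gamma\vdash_{\mathbf H_0}A$.
   Context: Fix a standard first-order language with connectives $\wedge,\vee,\rightarrow$, constant $\bot$, quantifiers $\forall,\exists$; $\neg A$ abbreviates $A\rightarrow\bot$. A Gödel set is a closed $V\subseteq[0,1]$ with $0,1\in V$. A $V$-interpretation $\mathfrak I$ has a nonempty universe $U$, assigns to each $k$-ary predicate symbol a function $U^k\to V$, to each $k$-ary function symbol a function $U^k\to U$, and to each variable an element of $U$; truth values are: atomic formulas get the value of the predicate function on the term values, $\bot\mapsto 0$, $\wedge\mapsto\min$, $\vee\mapsto\max$, $\mathfrak I(A\rightarrow B)=1$ if $\mathfrak I(A)\le\mathfrak I(B)$ and $\mathfrak I(B)$ otherwise, $\forall\mapsto\inf$ and $\exists\mapsto\sup$ of the values of the instances $A(u)$, $u\in U$. $\Gamma\models_V A$ means: for every $V$-interpretation $\mathfrak I$, $\inf\{\mathfrak I(B):B\in\Gamma\}\le\mathfrak I(A)$. The Hilbert system $\mathbf H_0$ has the following axioms and rules (rules written as premises $\vdash$ conclusion): (I1) $A, A\rightarrow B\vdash B$; (I2) $A\rightarrow B, B\rightarrow C\vdash A\rightarrow C$; (I3) $A\vee A\rightarrow A$, $A\rightarrow A\wedge A$; (I4) $A\rightarrow A\vee B$, $A\wedge B\rightarrow A$; (I5) $A\vee B\rightarrow B\vee A$, $A\wedge B\rightarrow B\wedge A$; (I6) $A\rightarrow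 B\vdash C\vee A\rightarrow C\vee B$; (I7) $A\wedge B\rightarrow C\vdash A\rightarrow(B\rightarrow C)$; (I8) $A\rightarrow(B\rightarrow C)\vdash A\wedge B\rightarrow C$; (I9) $\bot\rightarrow A$; (I10) $B\rightarrow A(x)\vdash B\rightarrow\forall xA(x)$ if $x$ is not free in $B$; (I11) $\forall xA(x)\rightarrow A(t)$; (I12) $A(t)\rightarrow\exists xA(x)$; (I13) $A(x)\rightarrow B\vdash\exists xA(x)\rightarrow B$ if $x$ is not free in $B$; (QS) $\forall x(C\vee A(x))\rightarrow(C\vee\forall xA(x))$ if $x$ is not free in $C$; (LIN) $(A\rightarrow B)\vee(B\rightarrow A)$; (ISO$_0$) $\forall x\neg\neg A(x)\rightarrow\neg\neg\forall xA(x)$. $\Gamma\vdash_{\mathbf H_0}A$ means there is a finite sequence $A_0,\dots,A_n=A$ in which each $A_i$ is in $\Gamma$, an instance of an axiom, or the conclusion of a rule whose premises occur earlier in the sequence.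
   Formalization: The first-order language is assumed to have at most countably many predicate and function symbols; for uncountable languages the equivalence fails (e.g. Γ = {(p_β→p_α)→q : α<β<ω₁} entails q but does not derive it). *)

(* Defs.v *)
From mathcomp Require Import all_boot all_order all_algebra.
From mathcomp Require Import all_classical all_reals all_analysis.

Set Implicit Arguments.
Unset Strict Implicit.
Unset Printing Implicit Defensive.

Import Order.TTheory GRing.Theory Num.Theory.
Import numFieldNormedType.Exports.

Local Open Scope classical_set_scope.
Local Open Scope ring_scope.

(* At most countably many predicate and function symbols. This is essential:
   strong completeness for truth values in [0, 1] fails over uncountable
   languages. Arity 0 is allowed. *)
Record signature := Signature {
  pred_sym : countType;
  fun_sym : countType;
  pred_arity : pred_sym -> nat;
  fun_arity : fun_sym -> nat }.

(* Variables are named by natural numbers. *)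
Inductive term (L : signature) : Type :=
| Var of nat
| App (f : fun_sym L) of ('I_(fun_arity f) -> term L).

Inductive formula (L : signature) : Type :=
| Bot
| Atom (p : pred_sym L) of ('I_(pred_arity p) -> term L)
| And of formula L & formula L
| Or of formula L & formula L
| Imp of formula L & formula L
| All of nat & formula L
| Ex of nat & formula L.

Arguments Var {L}.
Arguments Bot {L}.

Definition Neg (L : signature) (A : formula L) : formula L := Imp A Bot.

Section Syntax.
Variable L : signature.

Fixpoint occurs (x : nat) (s : term L) : bool :=
  match s with
  | Var y => x == y
  | App f a => [exists i, occurs x (a i)]
  end.

Fixpoint free_in (x : nat) (A : formula L) : bool :=
  match A with
  | Bot => false
  | Atom p a => [exists i, occurs x (a i)]
  | And B C | Or B C | Imp B C => free_in x B || free_in x C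
  | All y B | Ex y B => (x != y) && free_in x B
  end.

Definition closed_formula (A : formula L) : Prop := forall x, ~~ free_in x A.

Fixpoint tsubst (x : nat) (t s : term L) : term L :=
  match s with
  | Var y => if y == x then t else Var y
  | App f a => App (fun i => tsubst x t (a i))
  end.

(* Does not rename bound variables: A(t) is only meaningful under
   [free_for t x A]. *)
Fixpoint fsubst (x : nat) (t : term L) (A : formula L) : formula L :=
  match A with
  | Bot => Bot
  | Atom p a => Atom (fun i => tsubst x t (a i))
  | And B C => And (fsubst x t B) (fsubst x t C)
  | Or B C => Or (fsubst x t B) (fsubst x t C)
  | Imp B C => Imp (fsubst x t B) (fsubst x t C)
  | All y B => All y (if y == x then B else fsubst x t B)
  | Ex y B => Ex y (if y == x then B else fsubst x t B)
  end.

(* No free occurrence of x in A lies in the scope of a quantifier binding a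
   variable of t. *)
Fixpoint free_for (t : term L) (x : nat) (A : formula L) : bool :=
  match A with
  | Bot | Atom _ _ => true
  | And B C | Or B C | Imp B C => free_for t x B && free_for t x C
  | All y B | Ex y B =>
      ~~ free_in x A || (~~ occurs y t && free_for t x B)
  end.

End Syntax.

Section Semantics.
Variables (R : realType) (L : signature).

Definition godel_set (V : set R) : Prop :=
  [/\ closed V, V `<=` `[0, 1], V 0 & V 1].

Record interpretation (V : set R) := Interpretation {
  universe : Type;
  universe_inhabited : inhabited universe;
  pred_val : forall p : pred_sym L, ('I_(pred_arity p) -> universe) -> R;
  pred_valP : forall p (a : 'I_(pred_arity p) -> universe), V (@pred_val p a);
  fun_val : forall f : fun_sym L, ('I_(fun_arity f) -> universe) -> universe;
  var_val : nat -> universe }.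

Arguments pred_val {V} _ p a.
Arguments fun_val {V} _ f a.

Section Eval.
Variables (V : set R) (I : interpretation V).

Fixpoint term_val (e : nat -> universe I) (s : term L) : universe I :=
  match s with
  | Var y => e y
  | App f a => fun_val I f (fun i => term_val e (a i))
  end.

(* The instance A(u) is evaluated by updating the assignment at x. The
   infimum and supremum are those of R; the families are nonempty and take
   their values in [0, 1] when V is a Goedel set. *)
Fixpoint formula_val (e : nat -> universe I) (A : formula L) : R :=
  match A with
  | Bot => 0
  | Atom p a => pred_val I p (fun i => term_val e (a i))
  | And B C => Num.min (formula_val e B) (formula_val e C)
  | Or B C => Num.max (formula_val e B) (formula_val e C)
  | Imp B C =>
      if formula_val e B <= formula_val e C then 1 else formula_val e C
  | All x B =>
      inf (range (fun u => formula_val (fun y => if y == x then u else e y) B))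
  | Ex x B =>
      sup (range (fun u => formula_val (fun y => if y == x then u else e y) B))
  end.

Definition truth_value (A : formula L) : R := formula_val (var_val I) A.

(* The infimum is taken in the lattice [0, 1], where inf set0 = 1; in R the
   library has inf set0 = 0, hence the added element 1. *)
Definition inf_truth_value (Gamma : set (formula L)) : R :=
  inf ([set 1] `|` [set truth_value B | B in Gamma]).

End Eval.

Definition entails (V : set R) (Gamma : set (formula L)) (A : formula L) :
    Prop :=
  forall I : interpretation V, inf_truth_value I Gamma <= truth_value I A.

End Semantics.

Section HilbertSystem.
Variable L : signature.
Implicit Types (A B C : formula L) (t : term L) (x : nat).

Inductive H0_axiom : formula L -> Prop :=
| I3_or A : H0_axiom (Imp (Or A A) A)
| I3_and A : H0_axiom (Imp A (And A A))
| I4_or A B : H0_axiom (Imp A (Or A B))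
| I4_and A B : H0_axiom (Imp (And A B) A)
| I5_or A B : H0_axiom (Imp (Or A B) (Or B A))
| I5_and A B : H0_axiom (Imp (And A B) (And B A))
| I9 A : H0_axiom (Imp Bot A)
| I11 A x t : free_for t x A -> H0_axiom (Imp (All x A) (fsubst x t A))
| I12 A x t : free_for t x A -> H0_axiom (Imp (fsubst x t A) (Ex x A))
| QS A C x : ~~ free_in x C ->
    H0_axiom (Imp (All x (Or C A)) (Or C (All x A)))
| LIN A B : H0_axiom (Or (Imp A B) (Imp B A))
| ISO0 A x : H0_axiom (Imp (All x (Neg (Neg A))) (Neg (Neg (All x A)))).

(* [H0_rule E B]: B is the conclusion of a rule whose premises lie in E. *)
Inductive H0_rule (E : set (formula L)) : formula L -> Prop :=
| I1 A B : E A -> E (Imp A B) -> H0_rule E B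
| I2 A B C : E (Imp A B) -> E (Imp B C) -> H0_rule E (Imp A C)
| I6 A B C : E (Imp A B) -> H0_rule E (Imp (Or C A) (Or C B))
| I7 A B C : E (Imp (And A B) C) -> H0_rule E (Imp A (Imp B C))
| I8 A B C : E (Imp A (Imp B C)) -> H0_rule E (Imp (And A B) C)
| I10 A B x : ~~ free_in x B -> E (Imp B A) -> H0_rule E (Imp B (All x A))
| I13 A B x : ~~ free_in x B -> E (Imp A B) -> H0_rule E (Imp (Ex x A) B).

Definition H0_derives (Gamma : set (formula L)) A : Prop :=
  exists (n : nat) (D : 'I_n.+1 -> formula L),
    D ord_max = A /\
    forall i : 'I_n.+1,
      [\/ Gamma (D i), H0_axiom (D i)
        | H0_rule [set D j | j in [set j : 'I_n.+1 | (j < i)%N]] (D i)].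

End HilbertSystem.

(* Main.v *)
(* Soundness: for v <= 1, v <= (B -> C) iff min(v, B) <= C, so every rule preserves "the value
   is >= v under all assignments"; ISO0 is the only place where 0 must be isolated.

   Completeness: rename variables so that the bound variables of Gamma and A are odd, and use
   even variables as Henkin constants.  If Gamma does not derive A, extend Gamma to a prime
   theory T without A such that each rejected E -> forall x B (and each rejected
   (exists x B) -> E) comes with a rejected instance; (QS) makes this consistent.  Then
   B <= C iff (B -> C) in T is a countable total preorder in which quantifiers are the infima
   and suprema of their instances.

   All but countably many points of an uncountable V are limits of V from both sides, so a
   countable linear order can be mapped into V by inserting its elements one after the other
   into the open gaps left by the previous ones.  A gap is split alternately near its left and
   its right end; hence the gaps on either side of any given point shrink to it unless that
   point has an immediate neighbour, and existing infima and suprema are preserved.  Finally,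
   raise to 1 all values above a cut w that is not a value, and send the bottom class to 0:
   by ISO0 a universal formula in the bottom class has an instance there. *)
Require Import Defs.
From mathcomp Require Import all_boot all_order all_algebra.
From mathcomp Require Import all_classical all_reals all_analysis.
From mathcomp Require Import zify lra.

Set Implicit Arguments.
Unset Strict Implicit.
Unset Printing Implicit Defensive.

Import Order.TTheory GRing.Theory Num.Theory.
Import numFieldNormedType.Exports.

Local Open Scope classical_set_scope.
Local Open Scope ring_scope.

(** * Derivations *)

Section Derivations.
Variable L : signature.
Implicit Types (G E P : set (formula L)) (A B C D F : formula L).

(** A rule looks at the available formulas only through at most two premises, which coincide for
    one-premise rules. In this form a rule instance moves to another set of formulas without a new
    case analysis. *)
Lemma H0_rule_premises E B : H0_rule E B ->
  exists C D, [/\ E C, E D & forall E', E' C -> E' D -> H0_rule E' B].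
Proof.
case=> [A A1 hA hB|A A1 C h1 h2|A A1 C h|A A1 C h|A A1 C h|A A1 x hx h|A A1 x hx h].
- by exists A, (Imp A A1); split=> // E'; apply: I1.
- by exists (Imp A A1), (Imp A1 C); split=> // E'; apply: I2.
- by exists (Imp A A1), (Imp A A1); split=> // E' ? _; apply: I6.
- by exists (Imp (And A A1) C), (Imp (And A A1) C); split=> // E' ? _; apply: I7.
- by exists (Imp A (Imp A1 C)), (Imp A (Imp A1 C)); split=> // E' ? _; apply: I8.
- by exists (Imp A1 A), (Imp A1 A); split=> // E' ? _; apply: I10.
- by exists (Imp A A1), (Imp A A1); split=> // E' ? _; apply: I13.
Qed.

Lemma H0_rule_mono E E' B : E `<=` E' -> H0_rule E B -> H0_rule E' B.
Proof. by move=> sE /H0_rule_premises [C [D [/sE hP /sE hQ]]]; apply. Qed.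

(** Steps are indexed by natural numbers, so that derivations can be cut and concatenated without
    casts between ordinals. *)
Definition deriv_step G (n : nat) (d : nat -> formula L) : Prop :=
  [\/ G (d n), H0_axiom (d n) | H0_rule [set d j | j in [set j | (j < n)%N]] (d n)].

Lemma H0_derives_nat G A : H0_derives G A <->
  exists n d, d n = A /\ forall i, (i <= n)%N -> deriv_step G i d.
Proof.
split=> [[n [D [<- hD]]]|[n [d [<- hd]]]].
- exists n, (fun i => D (inord i)); split.
    by congr D; apply: val_inj; rewrite /= inordK.
  move=> i lin; have := hD (inord i); case=> h; rewrite /deriv_step;
    [exact: Or31|exact: Or32|apply: Or33].
  apply: H0_rule_mono h => _ [j /= ji <-]; exists (val j); rewrite ?inord_val //.
  by move: ji; rewrite inordK.
- exists n, (fun i => d i); split=> // i.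
  have [|h|h|h] := hd i; [exact: (ltn_ord i)|exact: Or31|exact: Or32|apply: Or33].
  apply: H0_rule_mono h => _ [j /= ji <-].
  by exists (Ordinal (ltn_trans ji (ltn_ord i))).
Qed.

Lemma H0_derives_ind G P : G `<=` P -> @H0_axiom L `<=` P ->
  (forall B, H0_rule P B -> P B) -> forall A, H0_derives G A -> P A.
Proof.
move=> GP aP rP A /H0_derives_nat [n [d [<- hd]]].
elim/ltn_ind: n hd => n IH hd; have [/GP//|/aP//|h] := hd n (leqnn n).
apply: rP; apply: H0_rule_mono h => _ [j /= jn <-]; apply: IH => // i ij.
by apply: hd; apply: leq_trans ij (ltnW jn).
Qed.

Lemma derives_hyp G A : G A -> H0_derives G A.
Proof. by move=> h; apply/H0_derives_nat; exists 0%N, (fun=> A); split=> // i _; apply: Or31. Qed.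

Lemma derives_ax G A : H0_axiom A -> H0_derives G A.
Proof. by move=> h; apply/H0_derives_nat; exists 0%N, (fun=> A); split=> // i _; apply: Or32. Qed.

Lemma derives_rule G B : H0_rule (H0_derives G) B -> H0_derives G B.
Proof.
move=> /H0_rule_premises [C [D [/H0_derives_nat [n [d [dP hd]]] /H0_derives_nat [m [c [cQ hc]]]
  hr]]].
apply/H0_derives_nat; exists (n + m).+2.
(* The first derivation occupies positions [0] to [n], the second [n.+1] to [(n + m).+1], and [B]
   comes last. *)
pose e i := if (i <= n)%N then d i else if (i <= (n + m).+1)%N then c (i - n.+1)%N else B.
have e1 i : (i <= n)%N -> e i = d i by rewrite /e => ->.
have e2 i : (i <= m)%N -> e (n.+1 + i)%N = c i.
  by move=> im; rewrite /e ifN ?ifT ?addKn //; lia.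
have e3 : e (n + m).+2 = B by rewrite /e ifN ?ifN // -ltnNge; lia.
exists e; split=> // i ilt.
have [lin|lni] := leqP i n.
  have [h|h|h] := hd i lin; rewrite /deriv_step (e1 i lin); [exact: Or31|exact: Or32|apply: Or33].
  apply: H0_rule_mono h => _ [j /= ji <-]; exists j => //; rewrite e1 //.
  exact: leq_trans (ltnW ji) lin.
have [lim|lmi] := leqP i (n + m).+1.
  have {lni} [k km ->] : exists2 k, (k <= m)%N & i = (n.+1 + k)%N.
    by exists (i - n.+1)%N; [rewrite leq_subLR addSn|rewrite subnKC].
  have [h|h|h] := hc k km; rewrite /deriv_step (e2 k km); [exact: Or31|exact: Or32|apply: Or33].
  apply: H0_rule_mono h => _ [j /= jk <-]; exists (n.+1 + j)%N => /=; rewrite ?ltn_add2l // e2 //.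
  exact: leq_trans (ltnW jk) km.
have -> : i = (n + m).+2 by apply/eqP; rewrite eqn_leq ilt lmi.
rewrite /deriv_step e3; apply: Or33; apply: hr.
  by exists n => /=; [lia|rewrite e1].
by exists (n.+1 + m)%N => /=; [lia|rewrite e2].
Qed.

End Derivations.

(** * The Lindenbaum preorder of [G] *)

Section Heyting.
Variables (L : signature) (G : set (formula L)).
Implicit Types (A B C D F : formula L).

Definition leF A B := H0_derives G (Imp A B).
Local Notation "A <<= B" := (leF A B) (at level 70, no associativity).
Definition Top : formula L := Imp Bot Bot.

Lemma derives_mp A B : H0_derives G A -> A <<= B -> H0_derives G B.
Proof. by move=> h1 h2; apply: derives_rule; apply: I1 h1 h2. Qed.

Lemma leF_trans B A C : A <<= B -> B <<= C -> A <<= C.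
Proof. by move=> h1 h2; apply: derives_rule; apply: I2 h1 h2. Qed.

Lemma leF_orl A B : A <<= Or A B. Proof. exact/derives_ax/I4_or. Qed.
Lemma leF_orC A B : Or A B <<= Or B A. Proof. exact/derives_ax/I5_or. Qed.
Lemma leF_andC A B : And A B <<= And B A. Proof. exact/derives_ax/I5_and. Qed.
Lemma leF_orr A B : B <<= Or A B. Proof. exact: leF_trans (leF_orl _ _) (leF_orC _ _). Qed.
Lemma leF_andl A B : And A B <<= A. Proof. exact/derives_ax/I4_and. Qed.
Lemma leF_andr A B : And A B <<= B. Proof. exact: leF_trans (leF_andC _ _) (leF_andl _ _). Qed.
Lemma leF_bot A : Bot <<= A. Proof. exact/derives_ax/I9. Qed.

Lemma leF_refl A : A <<= A.
Proof. exact: leF_trans (leF_orl A A) (derives_ax _ (I3_or A)). Qed.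
#[local] Hint Resolve leF_refl : core.

Lemma leF_or A B C : A <<= C -> B <<= C -> Or A B <<= C.
Proof.
move=> h1 h2; have h3 : Or A B <<= Or A C by apply: derives_rule; apply: I6.
have h4 : Or C A <<= Or C C by apply: derives_rule; apply: I6.
apply: leF_trans h3 _; apply: leF_trans (leF_orC _ _) _; apply: leF_trans h4 _.
exact/derives_ax/I3_or.
Qed.

Lemma leF_impP A B C : A <<= Imp B C <-> And A B <<= C.
Proof. by split=> h; apply: derives_rule; [apply: I8|apply: I7]. Qed.

(** Exporting [And A B <<= And A B] and composing with each hypothesis in turn gives
    [And C C <<= And A B]; contraction of [C] finishes. *)
Lemma leF_and A B C : C <<= A -> C <<= B -> C <<= And A B.
Proof.
move=> h1 h2; have /leF_impP h3 := leF_refl (And A B).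
have /leF_impP h4 := leF_trans h1 h3.
have /leF_impP h5 := leF_trans (leF_andC _ _) h4.
have /leF_impP h6 := leF_trans h2 h5.
by apply: leF_trans h6; apply/derives_ax/I3_and.
Qed.

Lemma leF_top A : A <<= Top.
Proof. by apply/leF_impP; apply: leF_andr. Qed.

Lemma derives_leF A B : H0_derives G A -> B <<= A.
Proof. by move=> h; apply: (derives_mp h); apply/leF_impP/leF_andl. Qed.

Lemma top_leF A : Top <<= A -> H0_derives G A.
Proof. by apply: derives_mp; apply: leF_refl. Qed.

Lemma leF_mp A B : And (Imp A B) A <<= B.
Proof. exact/leF_impP. Qed.

Lemma leF_or2 A A' B B' : A <<= A' -> B <<= B' -> Or A B <<= Or A' B'.
Proof.
by move=> h1 h2; apply: leF_or;
  [apply: leF_trans h1 (leF_orl _ _)|apply: leF_trans h2 (leF_orr _ _)].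
Qed.

(** Both [f] and [D] lie below [Imp t f], hence so does [t]. This guarantees that any [D] can be
    either accepted or rejected consistently. *)
Lemma leF_cut t f D : And t D <<= f -> t <<= Or f D -> t <<= f.
Proof.
move=> h1 h2; have h3 : D <<= Imp t f.
  by apply/leF_impP; apply: leF_trans (leF_andC _ _) h1.
have h4 : f <<= Imp t f by apply/leF_impP/leF_andl.
have /leF_impP h5 := leF_trans h2 (leF_or h4 h3).
exact: leF_trans (leF_and (leF_refl t) (leF_refl t)) h5.
Qed.

Lemma leF_all_intro x A B : ~~ free_in x B -> B <<= A -> B <<= All x A.
Proof. by move=> hx h; apply: derives_rule; apply: I10. Qed.

Lemma leF_ex_elim x A B : ~~ free_in x B -> A <<= B -> Ex x A <<= B.
Proof. by move=> hx h; apply: derives_rule; apply: I13. Qed.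

Lemma leF_all_elim x t A : free_for t x A -> All x A <<= fsubst x t A.
Proof. by move=> h; apply/derives_ax/I11. Qed.

Lemma leF_ex_intro x t A : free_for t x A -> fsubst x t A <<= Ex x A.
Proof. by move=> h; apply/derives_ax/I12. Qed.

Lemma leF_qs x C A : ~~ free_in x C -> All x (Or C A) <<= Or C (All x A).
Proof. by move=> h; apply/derives_ax/QS. Qed.

End Heyting.

(** * Variables, renaming and substitution *)

Section Variables.
Variable L : signature.
Implicit Types (A B C D : formula L) (s t : term L) (x y a : nat).

Fixpoint var_in x A : bool :=
  match A with
  | Bot => false
  | Atom p a => [exists i, occurs x (a i)]
  | And B C | Or B C | Imp B C => var_in x B || var_in x C
  | All y B | Ex y B => (x == y) || var_in x B
  end.

Fixpoint binds x A : bool :=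
  match A with
  | Bot | Atom _ _ => false
  | And B C | Or B C | Imp B C => binds x B || binds x C
  | All y B | Ex y B => (x == y) || binds x B
  end.

Lemma free_var_in x A : free_in x A -> var_in x A.
Proof.
elim: A => //= [B IB C IC|B IB C IC|B IB C IC|y B IB|y B IB].
1-3: by case/orP => [/IB|/IC] ->; rewrite ?orbT.
all: by case/andP=> _ /IB ->; rewrite orbT.
Qed.

Lemma term_bound s : exists N, forall x, (N <= x)%N -> ~~ occurs x s.
Proof.
elim: s => [n|f a IH].
  by exists n.+1 => x nx /=; rewrite neq_ltn nx orbT.
have [N hN] := choice IH; exists (\max_i N i)%N => x hx /=.
apply/existsPn => i; apply: hN; apply: leq_trans hx.
exact: leq_bigmax.
Qed.

Lemma formula_bound A : exists N, forall x, (N <= x)%N -> ~~ var_in x A.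
Proof.
have two (P Q : nat -> bool) : (exists N, forall x, (N <= x)%N -> ~~ P x) ->
   (exists N, forall x, (N <= x)%N -> ~~ Q x) -> exists N, forall x, (N <= x)%N ->
     ~~ (P x || Q x).
  move=> [N hN] [M hM]; exists (maxn N M) => x; rewrite geq_max => /andP[/hN h1 /hM h2].
  by rewrite negb_or h1.
have one y : exists N, forall x, (N <= x)%N -> ~~ (x == y).
  by exists y.+1 => x yx; rewrite neq_ltn yx orbT.
elim: A => [|p a|B IB C IC|B IB C IC|B IB C IC|y B IB|y B IB] /=; try exact: two.
  by exists 0%N.
have [N hN] := choice (fun i => term_bound (a i)); exists (\max_i N i)%N => x hx /=.
apply/existsPn => i; apply: hN; apply: leq_trans hx.
exact: leq_bigmax.
Qed.

Lemma tsubst_id x s : tsubst x (Var x) s = s.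
Proof.
elim: s => [y|f a IH] /=; first by case: eqP => // ->.
by congr App; apply/funext.
Qed.

Lemma fsubst_id x A : fsubst x (Var x) A = A.
Proof.
elim: A => //= [p a|B -> C ->|B -> C ->|B -> C ->|y B ->|y B ->] //; try by rewrite if_same.
by congr Atom; apply/funext => i; rewrite tsubst_id.
Qed.

Lemma free_for_binds t x A : (forall y, binds y A -> ~~ occurs y t) -> free_for t x A.
Proof.
elim: A => //= [B IB C IC|B IB C IC|B IB C IC|y B IB|y B IB] h.
1-3: by rewrite IB ?IC // => y hy; apply: h; rewrite hy ?orbT.
all: rewrite h ?eqxx //= IB ?orbT // => z hz; apply: h; by rewrite hz orbT.
Qed.

Lemma free_for_id x A : free_for (Var x) x A.
Proof.
elim: A => //= [B -> C ->|B -> C ->|B -> C ->|y B ->|y B ->] //.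
all: by rewrite eq_sym; case: eqP; rewrite ?orbT.
Qed.

Lemma tsubst_fresh_back a x s : ~~ occurs a s -> tsubst a (Var x) (tsubst x (Var a) s) = s.
Proof.
elim: s => [y|f b IH] /=.
  case: (eqVneq y x) => [->|_] /=; first by rewrite eqxx.
  by rewrite eq_sym => /negbTE ->.
by move/existsPn => h; congr App; apply/funext => i; apply: IH.
Qed.

Lemma tsubst_fresh t x s : ~~ occurs x s -> tsubst x t s = s.
Proof.
elim: s => [y|f b IH] /=; first by rewrite eq_sym => /negbTE ->.
by move/existsPn => h; congr App; apply/funext => i; apply: IH.
Qed.

Lemma fsubst_notin t x A : ~~ free_in x A -> fsubst x t A = A.
Proof.
elim: A => //= [p b|B IB C IC|B IB C IC|B IB C IC|y B IB|y B IB].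
- by move/existsPn => h; congr Atom; apply/funext => i; apply: tsubst_fresh.
1-3: by rewrite negb_or => /andP[/IB -> /IC ->].
all: by rewrite (eq_sym y); case: eqP => //= _ /IB ->.
Qed.

(** Freshness must exclude [a] as a bound variable too: a quantifier over [a] would block the
    substitution on the way back. *)
Lemma fsubst_fresh_back a x A : ~~ var_in a A -> fsubst a (Var x) (fsubst x (Var a) A) = A.
Proof.
elim: A => //= [p b|B IB C IC|B IB C IC|B IB C IC|y B IB|y B IB].
- by move/existsPn => h; congr Atom; apply/funext => i; apply: tsubst_fresh_back.
1-3: by rewrite negb_or => /andP[/IB -> /IC ->].
all: rewrite negb_or => /andP[ay aB]; rewrite eq_sym (negbTE ay).
all: by case: (eqVneq y x) => _; [rewrite fsubst_notin //; apply: contra aB;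
  exact: free_var_in|rewrite IB].
Qed.

Lemma free_for_fresh_back a x A : ~~ var_in a A -> free_for (Var x) a (fsubst x (Var a) A).
Proof.
elim: A => //= [B IB C IC|B IB C IC|B IB C IC|y B IB|y B IB].
1-3: by rewrite negb_or => /andP[/IB -> /IC ->].
all: rewrite negb_or => /andP[ay aB]; case: (eqVneq y x) => [_|_] /=.
1,3: by rewrite (negbTE (contra (@free_var_in _ _) aB)) andbF.
all: by rewrite IB // orbT.
Qed.

Lemma notin_tsubst x t s : ~~ occurs x t -> ~~ occurs x (tsubst x t s).
Proof.
move=> xt; elim: s => [y|f b IH] /=.
  by case: (eqVneq y x) => //= ; rewrite eq_sym.
exact/existsPn.
Qed.

Lemma notin_fsubst x t A : ~~ occurs x t -> ~~ free_in x (fsubst x t A).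
Proof.
move=> xt; elim: A => //= [p b|B IB C IC|B IB C IC|B IB C IC|y B IB|y B IB].
- by apply/existsPn => i; apply: notin_tsubst.
1-3: by rewrite negb_or IB.
all: by rewrite (eq_sym y); case: eqP => //= _; rewrite IB.
Qed.

End Variables.

(** * Injective renaming of variables *)

Section Renaming.
Variables (L : signature) (r : nat -> nat).
Implicit Types (A B C D : formula L) (s t : term L) (x y a : nat).

Fixpoint tren s : term L :=
  match s with Var y => Var (r y) | App f a => App (fun i => tren (a i)) end.

Fixpoint ren A : formula L :=
  match A with
  | Bot => Bot
  | Atom p a => Atom (fun i => tren (a i))
  | And B C => And (ren B) (ren C)
  | Or B C => Or (ren B) (ren C)
  | Imp B C => Imp (ren B) (ren C)
  | All y B => All (r y) (ren B)
  | Ex y B => Ex (r y) (ren B)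
  end.

Lemma binds_ren y A : binds y (ren A) -> exists z, y = r z.
Proof.
elim: A => //= [B IB C IC|B IB C IC|B IB C IC|z B IB|z B IB].
1-3: by case/orP.
all: by case/orP => // /eqP ->; exists z.
Qed.

Hypothesis r_inj : injective r.

Lemma occurs_tren x s : occurs (r x) (tren s) = occurs x s.
Proof.
elim: s => [y|f a IH] /=; first by rewrite inj_eq.
exact: eq_existsb.
Qed.

Lemma free_in_ren x A : free_in (r x) (ren A) = free_in x A.
Proof.
elim: A => //= [p a|B -> C ->|B -> C ->|B -> C ->|y B ->|y B ->] //; try by rewrite inj_eq.
by apply: eq_existsb => i; rewrite occurs_tren.
Qed.

Lemma tren_tsubst x t s : tren (tsubst x t s) = tsubst (r x) (tren t) (tren s).
Proof.
elim: s => [y|f a IH] /=; first by rewrite inj_eq //; case: eqP.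
by congr App; apply/funext.
Qed.

Lemma ren_fsubst x t A : ren (fsubst x t A) = fsubst (r x) (tren t) (ren A).
Proof.
elim: A => //= [p a|B -> C ->|B -> C ->|B -> C ->|y B IB|y B IB] //.
- by congr Atom; apply/funext => i; rewrite tren_tsubst.
all: by rewrite inj_eq //; case: eqP; rewrite ?IB.
Qed.

Lemma free_for_ren x t A : free_for (tren t) (r x) (ren A) = free_for t x A.
Proof.
elim: A => //= [B -> C ->|B -> C ->|B -> C ->|y B IB|y B IB] //.
all: by rewrite inj_eq // free_in_ren occurs_tren IB.
Qed.

Lemma H0_axiom_ren A : H0_axiom A -> H0_axiom (ren A).
Proof.
case=> /=; try by [constructor].
- by move=> B x t h; rewrite ren_fsubst; apply: I11; rewrite free_for_ren.
- by move=> B x t h; rewrite ren_fsubst; apply: I12; rewrite free_for_ren.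
- by move=> B C x h; apply: QS; rewrite free_in_ren.
Qed.

Lemma H0_rule_ren E (E' : set (formula L)) B : (forall C, E C -> E' (ren C)) ->
  H0_rule E B -> H0_rule E' (ren B).
Proof.
move=> h; case => /=.
- by move=> A C /h hA /h; apply: I1.
- by move=> A C D /h h1 /h h2; apply: I2 h1 h2.
- by move=> A C D /h h1; apply: I6.
- by move=> A C D /h h1; apply: I7.
- by move=> A C D /h h1; apply: I8.
- by move=> A C x h1 /h; apply: I10; rewrite free_in_ren.
- by move=> A C x h1 /h; apply: I13; rewrite free_in_ren.
Qed.

End Renaming.

Lemma tren_id (L : signature) (r q : nat -> nat) (s : term L) :
  (forall x, occurs x s -> q (r x) = x) -> tren q (tren r s) = s.
Proof.
elim: s => [y|f a IH] h /=; first by rewrite h //=.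
congr App; apply/funext => i; apply: IH => x hx; apply: h => /=.
by apply/existsP; exists i.
Qed.

Lemma ren_id (L : signature) (r q : nat -> nat) (A : formula L) :
  (forall x, var_in x A -> q (r x) = x) -> ren q (ren r A) = A.
Proof.
elim: A => //= [p a|B IB C IC|B IB C IC|B IB C IC|y B IB|y B IB] h.
- congr Atom; apply/funext => i; apply: tren_id => x hx; apply: h.
  by apply/existsP; exists i.
1-3: by rewrite IB ?IC // => x hx; apply: h; rewrite hx ?orbT.
all: by rewrite h ?eqxx // IB // => x hx; apply: h; rewrite hx orbT.
Qed.

Definition odd_ren (n : nat) : nat := n.*2.+1.

(* An injective left inverse of odd_ren up to M, so that a finite derivation of renamed
   formulas can be renamed back. *)
Definition odd_unren (M n : nat) : nat :=
  if odd n && (n./2 <= M)%N then n./2 else (n + M.+1)%N.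

Lemma odd_unren_inj M : injective (odd_unren M).
Proof.
move=> m n; rewrite /odd_unren.
have := odd_double_half m; have := odd_double_half n.
by case: (odd m); case: (odd n) => /=; do ?case: ifP; lia.
Qed.

Lemma odd_renK M n : (n <= M)%N -> odd_unren M (odd_ren n) = n.
Proof. by move=> h; rewrite /odd_unren /odd_ren /= odd_double uphalf_double h. Qed.

(** The bound [M] must exceed the variables of all hypotheses used. The induction therefore proves
    derivability for all large [M], and two premises are combined by taking a maximum. *)
Lemma derives_unren (L : signature) (G : set (formula L)) A :
  H0_derives (ren odd_ren @` G) (ren odd_ren A) -> H0_derives G A.
Proof.
have unrenK (B : formula L) : exists N, forall M, (N <= M)%N ->
  ren (odd_unren M) (ren odd_ren B) = B.
  have [N hN] := formula_bound B; exists N => M NM; apply: ren_id => x hx.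
  apply: odd_renK; apply: leq_trans NM; rewrite leqNgt; apply: contraL hx => /ltnW.
  exact: hN.
pose P C := exists N, forall M, (N <= M)%N -> H0_derives G (ren (odd_unren M) C).
suff h : forall C, H0_derives (ren odd_ren @` G) C -> P C.
  move=> /h [N hN]; have [N' hN'] := unrenK A.
  have := hN (maxn N N') (leq_maxl _ _); by rewrite hN' // leq_maxr.
apply: H0_derives_ind => [_ [B GB <-]|C hC|B /H0_rule_premises [C [D [[N hN] [N' hN'] hr]]]].
- by have [N hN] := unrenK B; exists N => M /hN ->; apply: derives_hyp.
- by exists 0%N => M _; apply: derives_ax; apply: H0_axiom_ren hC; apply: odd_unren_inj.
- exists (maxn N N') => M; rewrite geq_max => /andP[/hN h1 /hN' h2].
  apply: derives_rule; apply: (H0_rule_ren (@odd_unren_inj M) (E := [set C; D])).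
    by move=> F [->|->].
  by apply: hr; [left|right].
Qed.

(** * Simultaneous substitution *)

Section SimultaneousSubstitution.
Variable L : signature.
Implicit Types (A B C D : formula L) (s t : term L) (x y a : nat) (e : nat -> term L).

(** Convertible to the update of assignments written out in [formula_val]. *)
Definition upd (U : Type) x (u : U) (e : nat -> U) : nat -> U :=
  fun y => if y == x then u else e y.

Fixpoint tsub e s : term L :=
  match s with Var y => e y | App f a => App (fun i => tsub e (a i)) end.

Fixpoint fsub e A : formula L :=
  match A with
  | Bot => Bot
  | Atom p a => Atom (fun i => tsub e (a i))
  | And B C => And (fsub e B) (fsub e C)
  | Or B C => Or (fsub e B) (fsub e C)
  | Imp B C => Imp (fsub e B) (fsub e C)
  | All y B => All y (fsub (upd y (Var y) e) B)
  | Ex y B => Ex y (fsub (upd y (Var y) e) B)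
  end.

Lemma binds_fsub y e A : binds y (fsub e A) = binds y A.
Proof.
by elim: A e => //= [B IB C IC|B IB C IC|B IB C IC|z B IB|z B IB] e; rewrite ?IB ?IC.
Qed.

Lemma tsubst_tsub x t e s : (forall y, y != x -> ~~ occurs x (e y)) ->
  tsubst x t (tsub (upd x (Var x) e) s) = tsub (upd x t e) s.
Proof.
move=> h; elim: s => [y|f a IH] /=; last by congr App; apply/funext.
rewrite /upd; case: (eqVneq y x) => [_|yx] /=; first by rewrite eqxx.
exact/tsubst_fresh/h.
Qed.

Lemma upd_upd (U : Type) x (u v : U) (e : nat -> U) : upd x u (upd x v e) = upd x u e.
Proof. by apply/funext => y; rewrite /upd; case: eqP. Qed.

Lemma updC (U : Type) x y (u v : U) (e : nat -> U) : x != y ->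
  upd x u (upd y v e) = upd y v (upd x u e).
Proof.
by move=> xy; apply/funext => z; rewrite /upd; case: (eqVneq z x) => // ->; rewrite (negbTE xy).
Qed.

(** The terms put for the other variables do not mention [x], so the second substitution only meets
    the [x] that the first one left in place. It is applied to the body of a quantifier over [x]. *)
Lemma fsubst_fsub x t e A : (forall y, y != x -> ~~ occurs x (e y)) ->
  fsubst x t (fsub (upd x (Var x) e) A) = fsub (upd x t e) A.
Proof.
elim: A e => //= [p a|B IB C IC|B IB C IC|B IB C IC|z B IB|z B IB] e h.
- by congr Atom; apply/funext => i; apply: tsubst_tsub.
1-3: by rewrite IB ?IC.
all: case: (eqVneq z x) => [->|zx]; first by rewrite !upd_upd.
all: rewrite !(updC _ _ _ zx) IB // => y yx; rewrite {1}/upd; case: (eqVneq y z) => [_|_] /=.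
1,3: by rewrite eq_sym.
all: exact: h.
Qed.

End SimultaneousSubstitution.

(** * Fresh instances of quantified formulas *)

Section Fresh.
Variables (L : signature) (G : set (formula L)).
Implicit Types (A B C D E f t : formula L).
Local Notation "A <<= B" := (leF G A B) (at level 70, no associativity).

Lemma leF_all_id a B : All a B <<= B.
Proof. by rewrite -{2}(fsubst_id a B); apply/leF_all_elim/free_for_id. Qed.

(** Generalisation over [a], after which (QS) moves the quantifier past the side formula [f]. *)
Lemma leF_gen a t f C : ~~ var_in a t -> ~~ var_in a f ->
  t <<= Or f C -> t <<= Or f (All a C).
Proof.
move=> at' af h; apply: leF_trans (leF_qs G _ (contra (@free_var_in _ _ _) af)).
exact: leF_all_intro (contra (@free_var_in _ _ _) at') h.
Qed.

(** Used contrapositively: rejecting a fresh instance along with [Imp C (All x B)] stays consistent.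
    Generalise over [a], pull the quantifier into the consequent, and rename it to [x]. *)
Lemma leF_all_fresh a t f C x B : ~~ var_in a t -> ~~ var_in a f ->
  ~~ var_in a (Imp C (All x B)) ->
  t <<= Or f (Imp C (fsubst x (Var a) B)) -> t <<= Or f (Imp C (All x B)).
Proof.
move=> at' af /=; rewrite !negb_or => /and3P[aC ax aB].
move=> /(leF_gen at' af) h; apply: leF_trans h _; apply: leF_or2; first exact: leF_refl.
apply/leF_impP.
have h1 : And (All a (Imp C (fsubst x (Var a) B))) C <<= All a (fsubst x (Var a) B).
  apply: leF_all_intro; first by rewrite /= eqxx /= (contra (@free_var_in _ _ _) aC).
  by apply/leF_impP; apply: leF_all_id.
apply: leF_trans h1 _; apply: leF_all_intro.
  by rewrite /= negb_and notin_fsubst ?orbT //= eq_sym.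
rewrite -{2}(fsubst_fresh_back x aB); apply: leF_all_elim.
exact: free_for_fresh_back.
Qed.

Lemma leF_ex_fresh a t f C x B : ~~ var_in a t -> ~~ var_in a f ->
  ~~ var_in a (Imp (Ex x B) C) ->
  t <<= Or f (Imp (fsubst x (Var a) B) C) -> t <<= Or f (Imp (Ex x B) C).
Proof.
move=> at' af /=; rewrite !negb_or => /andP[/andP[ax aB] aC].
move=> /(leF_gen at' af) h; apply: leF_trans h _; apply: leF_or2; first exact: leF_refl.
apply/leF_impP; apply: leF_trans (leF_andC _ _ _) _; apply/leF_impP.
(* The universal formula is moved to the right of the inequality, where [a] is not free, so that the
   existential can be eliminated. *)
have h1 : Ex a (fsubst x (Var a) B) <<= Imp (All a (Imp (fsubst x (Var a) B) C)) C.
  apply: leF_ex_elim; first by rewrite /= eqxx /= (contra (@free_var_in _ _ _) aC).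
  apply/leF_impP; apply: leF_trans (leF_andC _ _ _) _; apply/leF_impP.
  exact: leF_all_id.
apply: leF_trans h1; apply: leF_ex_elim.
  by rewrite /= negb_and notin_fsubst ?orbT //= eq_sym.
rewrite -{1}(fsubst_fresh_back x aB); apply: leF_ex_intro.
exact: free_for_fresh_back.
Qed.

End Fresh.

(** * Embedding countable linear orders into closed sets *)

Section GapInsertion.
Variables (R : realType) (X : Type) (le : X -> X -> Prop) (enum : nat -> X).
Hypothesis le_refl : forall x, le x x.
Hypothesis le_trans : forall y x z, le x y -> le y z -> le x z.
Hypothesis le_total : forall x y, le x y \/ le y x.
Hypothesis enum_surj : forall x, exists n, enum n = x.
Variables (bot top : X).
Hypothesis bot_le : forall x, le bot x.
Hypothesis le_top : forall x, le x top.
Hypothesis top_bot : ~ le top bot.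
Variables (W : set R) (mid : bool -> R -> R -> R) (a b : R).
Hypothesis midW : forall p l r, W l -> W r -> l < r -> W (mid p l r).
Hypothesis mid_lt : forall p l r, W l -> W r -> l < r -> l < mid p l r < r.
Hypothesis Wa : W a.
Hypothesis Wb : W b.
Hypothesis ab : a < b.

Implicit Types (x y z : X) (s : R * R * bool) (n k : nat).

(* A state (l, r, p) with l < r is an open gap between the values l and r given to earlier
   elements; it remains to be split, near l or near r according to p. A state (v, v, false)
   means that the value v is definitive. *)
Definition lo s : R := s.1.1.
Definition hi s : R := s.1.2.

(** The element [q] is inserted at [m]. The class of [q] becomes definitive, everything below it
    keeps the left part, everything above it the right part, and the side of the next split
    changes. *)
Definition split_gap s (q x : X) : R * R * bool :=
  let m := mid s.2 (lo s) (hi s) in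
  if `[< le x q >] then if `[< le q x >] then (m, m, false) else (lo s, m, ~~ s.2)
  else (m, hi s, ~~ s.2).

(** Stage [k] inserts [enum k] and affects only the elements in the same open gap; equality of
    states serves as the test for being in the same gap. *)
Fixpoint gap n x : R * R * bool :=
  match n with
  | 0 => if `[< le x bot >] then (a, a, false)
         else if `[< le top x >] then (b, b, false) else (a, b, true)
  | k.+1 => if (lo (gap k x) < hi (gap k x)) && (gap k (enum k) == gap k x)
            then split_gap (gap k x) (enum k) x else gap k x
  end.

(** In the limit, [gap_le] yields monotonicity and [gap_found_inj] strictness. [gap_ends] supplies
    elements at the ends of a gap, as right continuity requires. *)
Record gap_inv n : Prop := GapInv {
  gapW : forall x, [/\ W (lo (gap n x)), W (hi (gap n x)) &
    lo (gap n x) < hi (gap n x) \/ gap n x = (lo (gap n x), lo (gap n x), false)];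
  gap_le : forall x y, le x y -> gap n x = gap n y \/ hi (gap n x) <= lo (gap n y);
  gap_found_inj : forall x y v, gap n x = (v, v, false) -> gap n y = (v, v, false) -> le x y;
  gap_ends : forall x, lo (gap n x) < hi (gap n x) ->
    (exists z, gap n z = (lo (gap n x), lo (gap n x), false)) /\
    (exists z, gap n z = (hi (gap n x), hi (gap n x), false)) }.

Lemma gap_inv0 : gap_inv 0.
Proof.
split=> /=.
- move=> x; case: asboolP => _; first by split=> //; right.
  by case: asboolP => _; split=> //=; [right|left].
- move=> x y xy; case: (asboolP (le y bot)) => yb.
    by rewrite asboolT; [left|exact: le_trans yb].
  case: (asboolP (le x bot)) => xb; first by right; case: asboolP => /= _; rewrite /lo/hi //= ltW.
  case: (asboolP (le top x)) => xt; first by rewrite asboolT; [left|exact: le_trans xy].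
  by case: asboolP; [right|left].
- move=> x y v; case: (asboolP (le x bot)) => [xb _ _|xb]; first exact: le_trans (bot_le _).
  have nab : a <> b by move=> e; move: ab; rewrite e ltxx.
  case: (asboolP (le top x)) => xt // [<- _]; case: (asboolP (le y bot)) => yb;
    first by case=> /nab.
  by case: asboolP => // ty _; apply: le_trans ty.
- move=> x; case: asboolP => xb; first by rewrite /lo/hi/= ltxx.
  case: asboolP => xt; first by rewrite /lo/hi/= ltxx.
  move=> _; split; [exists bot; rewrite asboolT //|].
  by exists top; rewrite asboolF // asboolT.
Qed.

Lemma gap_invS n : gap_inv n -> gap_inv n.+1.
Proof.
case=> iW ile ifound iends.
set S := gap n in iW ile ifound iends *; set q := enum n.
(* If [q] already has its definitive value, the stage changes nothing. *)
have [Wl Wr] := iW q; case=> [lr|Sq]; last first.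
  have E x : gap n.+1 x = S x.
    rewrite /= -/S -/q; case: eqP => [<-|]; last by rewrite andbF.
    by rewrite Sq /lo/hi /= ltxx.
  split=> [x|x y|x y v|x]; rewrite ?E; [exact: iW|exact: ile|exact: ifound|].
  move=> /iends [[y1 h1] [y2 h2]].
  by split; [exists y1|exists y2]; rewrite E.
have [l [r [p Sq]]] : exists l r p, S q = (l, r, p) by case: (S q) => [[l r] p]; exists l, r, p.
rewrite Sq /lo /hi /= in Wl Wr lr.
have E x : gap n.+1 x = if `[< S x = S q >] then split_gap (l, r, p) q x else S x.
  rewrite /= -/S -/q eq_sym; case: (asboolP (S x = S q)) => [->|/eqP/negbTE ->];
    last by rewrite andbF.
  by rewrite eqxx Sq /lo /hi /= lr.
set m := mid p l r.
have Wm : W m by exact: midW.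
have /andP[lm mr] : l < m < r by exact: mid_lt.
have nout x v : S x = (v, v, false) -> gap n.+1 x = (v, v, false).
  move=> h; rewrite E asboolF // h Sq => -[h1 h2 _]; by move: lr; rewrite -h1 -h2 ltxx.
have qE : gap n.+1 q = (m, m, false) by rewrite E asboolT // /split_gap !asboolT.
(* The value [m] is new: it lies strictly inside the gap of [q], whereas [gap_le] keeps every
   definitive value outside that gap. *)
have notm x : S x <> (m, m, false).
  move=> Sx; case: (le_total x q) => /ile; rewrite Sx Sq => -[[e1 e2 _]|].
  - by move: lr; rewrite -e1 -e2 ltxx.
  - by rewrite /hi/lo/= leNgt lm.
  - by move: lr; rewrite e1 e2 ltxx.
  - by rewrite /hi/lo/= leNgt mr.
split.
- move=> x; rewrite E; case: asboolP => // _; rewrite /split_gap.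
  by do 2?case: asboolP => _; split=> //; rewrite /lo /hi /=; [right|left|left].
- move=> x y xy; rewrite !E; case: (asboolP (S x = S q)) => [Sx|Sx];
   case: (asboolP (S y = S q)) => [Sy|Sy]; rewrite /split_gap /=.
  + case: (asboolP (le x q)) => xq; last first.
      by rewrite asboolF; [left|move=> yq; apply: xq; apply: le_trans yq].
    case: (asboolP (le q x)) => qx.
      rewrite (asboolT (le_trans qx xy)); case: asboolP => _; [by left|by right].
    case: asboolP => yq; last by right.
    by case: asboolP => _; [right|left].
  + case: (ile _ _ xy) => [h|]; first by case: Sy; rewrite -h.
    rewrite {1}/hi Sx Sq /= => ry; right; apply: Order.POrderTheory.le_trans ry.
    by do 2?case: asboolP => _; rewrite /hi/= ?lexx ?ltW.
  + case: (ile _ _ xy) => [h|]; first by case: Sx; rewrite h.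
    rewrite {2}/lo Sy Sq /= => ry; right; apply: (Order.POrderTheory.le_trans ry).
    by do 2?case: asboolP => _; rewrite /lo/= ?lexx ?ltW.
  + exact: ile.
- have aux x v : gap n.+1 x = (v, v, false) ->
      (S x = S q /\ v = m /\ le x q /\ le q x) \/ (S x = (v, v, false)).
    rewrite E; case: asboolP => Sx; last by right.
    rewrite /split_gap /lo /hi /= -/m; case: asboolP => xq; last first.
      by case=> e1 e2; move: mr; rewrite e1 e2 ltxx.
    case: asboolP => qx; last by case=> e1 e2; move: lm; rewrite e1 e2 ltxx.
    by case=> ->; left.
  move=> x y v /aux[[_ [-> [xq _]]]|Sx] /aux[[_ [e [_ qy]]]|Sy].
  + exact: le_trans qy.
  + by case: (notm y).
  + by case: (notm x); rewrite -e.
  + exact: ifound Sx Sy.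
- have [[zl hzl] [zr hzr]] : (exists z, S z = (l, l, false)) /\ (exists z, S z = (r, r, false)).
    by have := iends q; rewrite Sq; apply.
  move=> x; rewrite E; case: asboolP => Sx; last first.
    by move/iends => [[z1 h1] [z2 h2]]; split; [exists z1|exists z2]; exact: nout.
  rewrite /split_gap /lo /hi /= -/m; case: asboolP => xq; last first.
    by move=> _; split; [exists q|exists zr; exact: nout].
  case: asboolP => qx; first by rewrite ltxx.
  by move=> _; split; [exists zl; exact: nout|exists q].
Qed.

Lemma gapP n : gap_inv n.
Proof. by elim: n => [|n]; [exact: gap_inv0|exact: gap_invS]. Qed.

Lemma gap_foundS n k x v : gap n x = (v, v, false) -> gap (n + k) x = (v, v, false).
Proof.
move=> h; elim: k => [|k IH]; first by rewrite addn0.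
by rewrite addnS /= IH /lo /hi /= ltxx.
Qed.

Lemma gap_found n x : enum n = x -> exists v, gap n.+1 x = (v, v, false).
Proof.
move=> <-; have [_ _ [lr|e]] := gapW (gapP n) (enum n); last first.
  exists (lo (gap n (enum n))); rewrite /= e /lo /hi /= ltxx //.
by rewrite /= lr eqxx /= /split_gap !asboolT //; eexists.
Qed.

Lemma gap_limit : exists h : X -> R, forall x, exists n, gap n x = (h x, h x, false).
Proof.
have found x : exists v n, gap n x = (v, v, false).
  by have [n hn] := enum_surj x; have [v hv] := gap_found hn; exists v, n.+1.
by have [h hh] := choice found; exists h.
Qed.

Variable h : X -> R.
Hypothesis hP : forall x, exists n, gap n x = (h x, h x, false).

Lemma gap_limit_uniq n x v : gap n x = (v, v, false) -> v = h x.
Proof.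
move=> /gap_foundS hv; have [k /gap_foundS hk] := hP x.
by have := hv k; rewrite addnC hk => -[].
Qed.

Lemma gap_nested n x : lo (gap n x) <= h x <= hi (gap n x).
Proof.
have step k : lo (gap k x) <= lo (gap k.+1 x) /\ hi (gap k.+1 x) <= hi (gap k x).
  rewrite /=; case: ifP => // /andP[lr _]; have [Wl Wr _] := gapW (gapP k) x.
  have /andP[lm mr] := mid_lt (gap k x).2 Wl Wr lr.
  by rewrite /split_gap; do 2?case: asboolP => _; rewrite /lo /hi /= ?lexx ?ltW.
have steps k : lo (gap n x) <= lo (gap (n + k) x) /\ hi (gap (n + k) x) <= hi (gap n x).
  elim: k => [|k [IH1 IH2]]; first by rewrite addn0.
  have [h1 h2] := step (n + k)%N; rewrite addnS; split;
    first exact: Order.POrderTheory.le_trans h1.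
  exact: Order.POrderTheory.le_trans IH2.
have [k /gap_foundS hk] := hP x.
by have := steps k; rewrite addnC hk /lo /hi /= => -[-> ->].
Qed.

Lemma limit_in x : W (h x).
Proof. by have [n hn] := hP x; have [] := gapW (gapP n) x; rewrite hn. Qed.

(** At the common stage [n + m] both values are definitive, and the invariant applies to them. *)
Lemma limit_le x y : le x y <-> h x <= h y.
Proof.
have mono u w : le u w -> h u <= h w.
  move=> uw; have [n /gap_foundS hn] := hP u; have [m /gap_foundS hm] := hP w.
  have := gap_le (gapP (n + m)) uw; rewrite hn addnC hm /lo /hi /=.
  by case=> [[->]|].
split; first exact: mono.
move=> hxy; have [//|yx] := le_total x y.
have e : h x = h y by apply/eqP; rewrite eq_le hxy mono.
have [n /gap_foundS hn] := hP x; have [m /gap_foundS hm] := hP y.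
by apply: (gap_found_inj (gapP (n + m)) (hn m)); rewrite addnC hm e.
Qed.

Lemma limit_bot : h bot = a.
Proof. by symmetry; apply: (@gap_limit_uniq 0); rewrite /= asboolT. Qed.

Lemma limit_top : h top = b.
Proof. by symmetry; apply: (@gap_limit_uniq 0); rewrite /= asboolF // asboolT. Qed.

(** * Right continuity of the limit at points without an immediate successor *)

Section RightContinuity.
Variable c : bool.
Hypothesis mid_half : forall l r, W l -> W r -> l < r -> mid c l r - l <= (r - l) / 2.
Variable x : X.
Hypothesis x_top : ~ le top x.
Hypothesis x_dense : forall y, ~ le y x -> exists z, ~ le z x /\ ~ le y z.

Definition right_gap n p r y :=
  [/\ ~ le y x, gap n x = (h x, h x, false), gap n y = (h x, r, p) & h x < r].

(** The state of [z] is squeezed between those of [x] and [y], and it cannot be the definitive value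
    [h x], which is reserved for the class of [x]. *)
Lemma right_gap_sub n p r y z : right_gap n p r y -> ~ le z x -> le z y -> right_gap n p r z.
Proof.
move=> [yx gx gy xr] zx zy; split=> //.
have [//|] := gap_le (gapP n) zy; first by rewrite gy.
rewrite gy /lo /= => hz; case: (le_total x z) => // xz.
have [e|] := gap_le (gapP n) xz.
  by case: zx; apply: (gap_found_inj (gapP n) _ gx); rewrite -e.
rewrite gx /hi /= => lz; have [_ _ []] := gapW (gapP n) z.
  by move=> lr; have := lt_le_trans lr hz; rewrite ltNge lz.
move=> e; have e1 : lo (gap n z) = h x.
  apply/eqP; rewrite eq_le lz andbT; apply: Order.POrderTheory.le_trans hz.
  by rewrite e.
by case: zx; apply: (gap_found_inj (gapP n) (y := x) _ gx); rewrite e e1.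
Qed.

(** Follow [y] to the first stage that inserts some [z] into its gap. An element [y'] strictly
    between [x] and [z] then falls into the left part, which still starts at [h x]. *)
Lemma right_gap_split n p r y : right_gap n p r y ->
  exists n' y', right_gap n' (~~ p) (mid p (h x) r) y'.
Proof.
have [k hk] := hP y.
have : gap (n + k) y = (h y, h y, false) by rewrite addnC; apply: gap_foundS.
elim: k n {hk} => [|k IH] n; first by rewrite addn0 => e [_ _]; rewrite e => -[-> -> _];
  rewrite ltxx.
rewrite addnS -addSn => hk [yx gx gy xr].
have [e|ne] := pselect (gap n (enum n) = gap n y); last first.
  apply: (IH _ hk); split=> //; first by rewrite /= gx /lo /hi /= ltxx.
  by rewrite /= gy; case: eqP; rewrite ?andbF // -gy.
set z := enum n in e.
have zx : ~ le z x.
  move=> /(gap_le (gapP n)); rewrite e gx gy /lo /hi /= => -[[e1 _]|]; last by rewrite leNgt xr.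
  by move: xr; rewrite e1 ltxx.
have rz : right_gap n p r z by split=> //; rewrite e.
have [y' [y'x zy']] := x_dense zx.
have y'z : le y' z by case: (le_total y' z).
have [_ _ gy' _] := right_gap_sub rz y'x y'z.
have [Wl Wr _] := gapW (gapP n) z; rewrite e gy in Wl Wr.
have /andP[lm _] := mid_lt p Wl Wr xr.
exists n.+1, y'; split=> //; first by rewrite /= gx /lo /hi /= ltxx.
by rewrite /= -/z e gy gy' eqxx /lo /hi /= xr /split_gap asboolT // asboolF.
Qed.

(** For [x] in the bottom class the initial gap serves; otherwise the gap appears at the stage that
    places [x]. *)
Lemma right_gap_init : exists n p r y, right_gap n p r y.
Proof.
have [xb|xb] := pselect (le x bot).
  have [z [zx tz]] := x_dense x_top.
  have hx : h x = a by symmetry; apply: (@gap_limit_uniq 0); rewrite /= asboolT.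
  exists 0%N, true, b, z; rewrite /right_gap hx; split=> //=; first by rewrite asboolT.
  by rewrite !asboolF // => zb; apply: zx; apply: le_trans zb (bot_le _).
have [k hk] := hP x.
have : lo (gap 0 x) < hi (gap 0 x) by rewrite /= !asboolF.
have : gap (0 + k) x = (h x, h x, false) by [].
elim: k 0%N {hk} => [|k IH] n; first by rewrite addn0 => ->; rewrite /lo /hi /= ltxx.
rewrite addnS -addSn => hk lr.
have [e|ne] := pselect (gap n (enum n) = gap n x); last first.
  by apply: (IH _ hk); rewrite /=; case: eqP; rewrite ?andbF.
have [lr'|] := boolP (lo (gap n.+1 x) < hi (gap n.+1 x)); first exact: IH lr'.
set q := enum n in e.
have [Wl Wr _] := gapW (gapP n) x.
have /andP[lm mr] := mid_lt (gap n x).2 Wl Wr lr.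
have gE y : gap n y = gap n x -> gap n.+1 y = split_gap (gap n x) q y.
  by move=> ey; rewrite /= ey lr -/q e eqxx.
rewrite gE // {1 2}/split_gap.
case: (asboolP (le x q)) => xq; last by rewrite /lo /hi /= -/(lo _) -/(hi _) mr.
case: (asboolP (le q x)) => qx; last by rewrite /lo /hi /= -/(lo _) -/(hi _) lm.
move=> _; set m := mid (gap n x).2 (lo (gap n x)) (hi (gap n x)) in lm mr.
have gx : gap n.+1 x = (m, m, false) by rewrite gE // /split_gap !asboolT.
have mx := gap_limit_uniq gx.
(* Some [z] sits at the right end of the gap that [x] leaves. An element [y] strictly between [x]
   and [z] is still in that gap and is now moved to its part right of [x]. *)
have [_ [z gz]] := gap_ends (gapP n) lr.
have nz u : gap n u <> gap n x \/ ~ le z u.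
  have [zu|] := pselect (le z u); [left|by right].
  have := gap_le (gapP n) zu; rewrite gz => -[<- e1|].
    by move: lr; rewrite -e1 /lo /hi /= ltxx.
  by move=> + e1; rewrite e1 {1}/hi /= leNgt lr.
have zx : ~ le z x by case: (nz x).
have [y [yx zy]] := x_dense zx.
have xy : le x y by case: (le_total x y).
have yz : le y z by case: (le_total y z).
have gy : gap n y = gap n x.
  have [//|ly] := gap_le (gapP n) xy.
  have [ey|] := gap_le (gapP n) yz.
    by case: zy; apply: (gap_found_inj (gapP n) gz); rewrite ey.
  rewrite gz /lo /= => ry; have [_ _ [|ey]] := gapW (gapP n) y.
    by move=> /lt_le_trans /(_ ry); rewrite ltNge ly.
  have e1 : lo (gap n y) = hi (gap n x).
    by apply/eqP; rewrite eq_le ly andbT; move: ry; rewrite {1}ey.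
  by case: zy; apply: (gap_found_inj (gapP n) gz); rewrite ey e1.
exists n.+1, (~~ (gap n x).2), (hi (gap n x)), y; rewrite /right_gap -mx; split=> //.
rewrite gE // /split_gap asboolF // => yq; apply: yx; exact: le_trans qx.
Qed.

(** The side of splitting alternates, so of any two consecutive splits of the gap right of [x] one
    is near its left end and at least halves it. *)
Lemma limit_right e : 0 < e -> exists y, ~ le y x /\ h y < h x + e.
Proof.
move=> e0; have [n0 [p0 [r0 [y0 rg0]]]] := right_gap_init.
have halve n p r y : right_gap n p r y ->
    exists n' p' r' y', right_gap n' p' r' y' /\ r' - h x <= (r - h x) / 2.
  have near n1 r1 y1 : right_gap n1 c r1 y1 ->
      exists n' p' r' y', right_gap n' p' r' y' /\ r' - h x <= (r1 - h x) / 2.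
    move=> rg; have [n' [y' rg']] := right_gap_split rg.
    exists n', (~~ c), (mid c (h x) r1), y'; split=> //.
    case: rg => _ _ g1 xr; have [Wl Wr _] := gapW (gapP n1) y1; rewrite g1 in Wl Wr.
    exact: mid_half.
  move=> rg; have [pc|pc] := eqVneq p c; first by apply: (near n _ y); rewrite -pc.
  have [n' [y' rg']] := right_gap_split rg.
  have pc' : ~~ p = c by move: pc; case: (p); case: (c).
  rewrite pc' in rg'; have [n2 [p2 [r2 [y2 [rg2 h2]]]]] := near _ _ _ rg'.
  exists n2, p2, r2, y2; split=> //; apply: (Order.POrderTheory.le_trans h2).
  case: rg => _ _ g1 xr; have [Wl Wr _] := gapW (gapP n) y; rewrite g1 in Wl Wr.
  have /andP[_ mr] := mid_lt p Wl Wr xr; rewrite /hi /= in mr.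
  by rewrite ler_pM2r ?invr_gt0 // lerD2r ltW.
have halves k : exists n p r y, right_gap n p r y /\ (r - h x) * 2 ^+ k <= r0 - h x.
  elim: k => [|k [n [p [r [y [/halve [n' [p' [r' [y' [rg' h1]]]]] h2]]]]]].
    by exists n0, p0, r0, y0; rewrite expr0 mulr1.
  exists n', p', r', y'; split=> //; apply: Order.POrderTheory.le_trans h2.
  by rewrite exprS mulrA ler_pM2r ?exprn_gt0 // -ler_pdivlMr.
(* After this many halvings the length is below [e], since [2 ^+ k] exceeds [(r0 - h x) / e] for [k]
   its Archimedean bound. *)
have hb := upper_nthrootP (leqnn (Num.Def.archi_bound ((r0 - h x) / e))).
have [n [p [r [y [[yx _ gy _] hr]]]]] := halves (Num.Def.archi_bound ((r0 - h x) / e)).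
exists y; split=> //; have /andP[_] := gap_nested n y; rewrite gy /hi /= => hy.
apply: (le_lt_trans hy); rewrite -ltrBlDl.
rewrite -(ltr_pM2r (x := 2 ^+ Num.Def.archi_bound ((r0 - h x) / e))) ?exprn_gt0 //.
by apply: (le_lt_trans hr); rewrite mulrC -ltr_pdivrMr.
Qed.

End RightContinuity.

End GapInsertion.

(** * Order reversal *)

Section Duality.
Variables (R : realType) (X : Type) (le : X -> X -> Prop) (enum : nat -> X).
Variables (bot top : X) (mid : bool -> R -> R -> R) (a b : R).
Hypothesis le_trans : forall y x z, le x y -> le y z -> le x z.
Hypothesis le_total : forall x y, le x y \/ le y x.
Hypothesis top_bot : ~ le top bot.

(** The construction commutes with reversing the order and negating the reals, so left continuity
    follows from right continuity. *)
Lemma gap_dual n x :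
  gap (fun x y => le y x) enum top bot (fun p l r => - mid p (- r) (- l)) (- b) (- a) n x =
  (- hi (gap le enum bot top mid a b n x), - lo (gap le enum bot top mid a b n x),
   (gap le enum bot top mid a b n x).2).
Proof.
have inj (s t : R * R * bool) : ((- hi s, - lo s, s.2) == (- hi t, - lo t, t.2)) = (s == t).
  case: s t => [[l r] p] [[l' r'] p']; rewrite /hi /lo /= !xpair_eqE !eqr_opp.
  by rewrite (andbC (r == r')).
elim: n x => [|n IH] x /=.
  case: (asboolP (le top x)) => xt; case: (asboolP (le x bot)) => xb //.
  by case: top_bot; apply: le_trans xb.
rewrite !IH {1 2}/lo {1 2}/hi /= ltrN2 inj; case: ifP => // _.
rewrite /split_gap /lo /hi /= !opprK.
case: (asboolP (le (enum n) x)) => qx; case: (asboolP (le x (enum n))) => xq //.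
by case: (le_total x (enum n)).
Qed.

End Duality.

(** * Embeddings preserving existing infima and suprema *)

Section OrderEmbedding.
Variables (R : realType) (X : Type) (le : X -> X -> Prop) (enum : nat -> X).
Hypothesis le_refl : forall x, le x x.
Hypothesis le_trans : forall y x z, le x y -> le y z -> le x z.
Hypothesis le_total : forall x y, le x y \/ le y x.
Hypothesis enum_surj : forall x, exists n, enum n = x.
Variables (bot top : X).
Hypothesis bot_le : forall x, le bot x.
Hypothesis le_top : forall x, le x top.
Hypothesis top_bot : ~ le top bot.

Definition glb (U : set X) (i : X) : Prop :=
  (forall u, U u -> le i u) /\ forall z, (forall u, U u -> le z u) -> le z i.

Definition lub (U : set X) (s : X) : Prop :=
  (forall u, U u -> le u s) /\ forall z, (forall u, U u -> le u z) -> le s z.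

Lemma order_embedding (W : set R) (a b : R) :
  (forall l r, W l -> W r -> l < r -> exists2 m, W m & l < m <= (l + r) / 2) ->
  (forall l r, W l -> W r -> l < r -> exists2 m, W m & (l + r) / 2 <= m < r) ->
  W a -> W b -> a < b ->
  exists h : X -> R, [/\ forall x, W (h x), forall x y, le x y <-> h x <= h y,
    h bot = a, h top = b & 
    (forall U i e, U !=set0 -> glb U i -> 0 < e -> exists2 u, U u & h u < h i + e) /\
    (forall U s e, U !=set0 -> lub U s -> 0 < e -> exists2 u, U u & h s - e < h u)].
Proof.
move=> denseL denseR Wa Wb ab.
(* The flag [true] asks for a point in the left half of the gap, [false] for one in the right half.
   The conditions stand under the existential so that choice yields a total function. *)
have mid_ex (plr : bool * (R * R)) : exists m, W plr.2.1 -> W plr.2.2 -> plr.2.1 < plr.2.2 ->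
    [/\ W m, plr.2.1 < m < plr.2.2, plr.1 -> m - plr.2.1 <= (plr.2.2 - plr.2.1) / 2 &
       ~~ plr.1 -> plr.2.2 - m <= (plr.2.2 - plr.2.1) / 2].
  case: plr => p [l r] /=.
  have [[Wl [Wr lr]]|no] := pselect (W l /\ W r /\ l < r); last by exists 0 => Wl Wr lr; case: no.
  case: p.
    have [m Wm /andP[lm mr]] := denseL _ _ Wl Wr lr; exists m => _ _ _.
    by split=> // [|_]; [apply/andP; split=> //|]; lra.
  have [m Wm /andP[lm mr]] := denseR _ _ Wl Wr lr; exists m => _ _ _.
  by split=> // [|_]; [apply/andP; split=> //|]; lra.
have [f hf] := choice mid_ex; pose mid p l r := f (p, (l, r)).
have midP p l r : W l -> W r -> l < r -> [/\ W (mid p l r), l < mid p l r < r,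
  p -> mid p l r - l <= (r - l) / 2 & ~~ p -> r - mid p l r <= (r - l) / 2].
  exact: hf (p, (l, r)).
have midW p l r : W l -> W r -> l < r -> W (mid p l r) by move=> Wl Wr /(midP p _ _ Wl Wr) [].
have mid_lt p l r : W l -> W r -> l < r -> l < mid p l r < r.
  by move=> Wl Wr /(midP p _ _ Wl Wr) [].
have [h hP] := gap_limit le_refl le_trans le_total enum_surj bot_le le_top top_bot midW mid_lt
  Wa Wb ab.
have hle := limit_le le_refl le_trans le_total bot_le le_top top_bot midW mid_lt Wa Wb ab hP.
exists h; split=> //.
- exact: (limit_in le_refl le_trans le_total bot_le le_top top_bot midW mid_lt Wa Wb ab hP).
- exact: (limit_bot le_refl hP).
- exact: (limit_top le_refl top_bot hP).
split=> [U i e [u0 Uu0] [lb glb] e0|U s e [u0 Uu0] [ub lub] e0].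
(* An attained infimum is immediate. Otherwise every element above [i] has a member of [U] strictly
   below it, so [i] has no immediate successor and right continuity applies. *)
- have [[u [Uu ui]]|no] := pselect (exists u, U u /\ le u i).
    by exists u => //; apply: (@le_lt_trans _ _ (h i)); [exact/hle|rewrite ltrDl].
  have lt u : U u -> ~ le u i by move=> Uu ui; apply: no; exists u.
  have below y : ~ le y i -> exists2 u, U u & ~ le y u.
    move=> yi; apply: contrapT => ne; apply: yi; apply: glb => u Uu.
    by apply: contrapT => yu; apply: ne; exists u.
  have [y [/below [u Uu yu] hy]] : exists y, ~ le y i /\ h y < h i + e.
  { apply: (limit_right le_refl le_trans le_total bot_le le_top
      top_bot midW mid_lt Wa Wb ab hP (c := true)) => //.
  + by move=> l r Wl Wr /(midP true _ _ Wl Wr) [_ _ /(_ isT)].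
  + by move=> ti; apply: (lt u0) => //; apply: le_trans ti.
  + by move=> y /below [u Uu yu]; exists u; split=> //; exact: lt. }
  exists u => //; apply: lt_trans hy; rewrite ltNge; apply/negP => /hle; exact: yu.
- have [[u [Uu ui]]|no] := pselect (exists u, U u /\ le s u).
    by exists u => //; apply: (@lt_le_trans _ _ (h s)); [rewrite ltrBlDr ltrDl|exact/hle].
  have lt u : U u -> ~ le s u by move=> Uu ui; apply: no; exists u.
  have above y : ~ le s y -> exists2 u, U u & ~ le u y.
    move=> yi; apply: contrapT => ne; apply: yi; apply: lub => u Uu.
    by apply: contrapT => yu; apply: ne; exists u.
  have hP' x : exists n, gap (fun x y => le y x) enum top bot (fun p l r => - mid p (- r) (- l))
      (- b) (- a) n x = (- h x, - h x, false).
    have [n hn] := hP x; exists n; rewrite gap_dual //; by rewrite hn.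
  (* Right continuity is applied to [- h] for the reversed order; there the splits with flag [false]
     are those near the left end. *)
  have [y [/above [u Uu yu] hy]] : exists y, ~ le s y /\ - h y < - h s + e.
  { apply: (limit_right (le := fun x y => le y x) _ _ _ _ _ _ (W := [set x | W (- x)])
      _ _ _ _ _ hP' (c := false)) => //=.
  + by move=> y x z yx zy; apply: le_trans yx.
  + by move=> p l r Wl Wr lr; rewrite opprK; apply: midW; rewrite ?ltrN2.
  + by move=> p l r Wl Wr lr; rewrite ltrNr andbC ltrNl; apply: mid_lt; rewrite ?ltrN2.
  + by rewrite opprK.
  + by rewrite opprK.
  + by rewrite ltrN2.
  + move=> l r Wl Wr lr; have := lr; rewrite -ltrN2.
    by move=> /(midP false _ _ Wr Wl) [_ _ _ /(_ isT)]; rewrite !opprK; lra.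
  + by move=> ti; apply: (lt u0) => //; apply: le_trans (bot_le _).
  + by move=> y /above [u Uu yu]; exists u; split=> //; exact: lt. }
  exists u => //; have : h y < h u by rewrite ltNge; apply/negP => /hle; exact: yu.
  by move: hy; lra.
Qed.

End OrderEmbedding.

Lemma countableU (T : Type) (A B : set T) : countable A -> countable B -> countable (A `|` B).
Proof.
move=> cA cB; have -> : A `|` B = \bigcup_(i in [set: bool]) (if i then A else B).
  apply/seteqP; split=> x; first by case=> ?; [exists true|exists false].
  by case=> -[] _; [left|right].
by apply: bigcup_countable => [|[] _]; rewrite ?countableP.
Qed.

Lemma countable_image (T U : Type) (f : T -> U) (A : set T) : countable A -> countable (f @` A).
Proof. by apply: sub_countable; exact: card_image_le. Qed.

Lemma countable_sub (T : Type) (A B : set T) : A `<=` B -> countable B -> countable A.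
Proof. by move=> /subset_card_le; exact: sub_countable. Qed.

(** * Two-sided condensation points *)

Section Condensation.
Variable R : realType.
Implicit Types (V : set R) (x : R).

Definition right_thin V : set R :=
  [set x | V x /\ exists2 e, 0 < e & countable (V `&` [set y | x < y < x + e])].

(** Every such point is in some [S q] with [q] rational. Apart from its infimum [s], [S q] is
    covered by the sets of points of [V] between [s + 1/(k+1)] and [q]; each is countable because a
    member of [S q] lies below [s + 1/(k+1)]. *)
Lemma countable_right_thin V : has_lbound V -> countable (right_thin V).
Proof.
move=> [m Vm].
pose S (q : rat) : set R :=
  [set x | [/\ V x, x < ratr q & countable (V `&` [set y | x < y < ratr q])]].
have cS q : countable (S q).
  have [->|/set0P Sn0] := eqVneq (S q) set0; first exact: countable0.
  have hS : has_inf (S q) by split=> //; exists m => x [/Vm].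
  pose F k := V `&` [set y | inf (S q) + k.+1%:R^-1 < y < ratr q].
  apply: (@countable_sub _ _ ([set inf (S q)] `|` \bigcup_(k in setT) F k)); last first.
    apply: countableU; first exact: countable1.
    apply: bigcup_countable => [|k _]; first exact: countableP.
    have [|x [Vx xq cx] xk] := @inf_adherent R (S q) k.+1%:R^-1 _ hS; first by rewrite invr_gt0.
    apply: countable_sub cx => y [Vy /= /andP[ky yq]]; split=> //=.
    by rewrite yq (lt_trans xk ky).
  move=> x Sx; have : inf (S q) <= x by apply: ge_inf => //; case: hS.
  rewrite le_eqVlt => /orP[/eqP ->|/ltr_add_invr [k hk]]; [by left|right].
  by exists k => //; case: Sx => Vx xq _; split=> //=; rewrite hk.
apply: (@countable_sub _ _ (\bigcup_(q in setT) S q)); last first.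
  by apply: bigcup_countable => [|q _]; [exact: countableP|exact: cS].
move=> x [Vx [e e0 ce]]; have [q] := rat_in_itvoo (ltr_pwDr e0 (lexx x)).
rewrite in_itv /= => /andP[xq qx]; exists q => //; split=> //.
by apply: countable_sub ce => y [Vy /= /andP[xy yq]]; split=> //=; rewrite xy (lt_trans yq).
Qed.

Definition left_thin V : set R :=
  [set x | V x /\ exists2 e, 0 < e & countable (V `&` [set y | x - e < y < x])].

Lemma countable_left_thin V : has_ubound V -> countable (left_thin V).
Proof.
move=> [m Vm].
have /(countable_image (@GRing.opp R)) : countable (right_thin [set x | V (- x)]).
  by apply: countable_right_thin; exists (- m) => x /Vm; rewrite lerNl.
apply: countable_sub => x [Vx [e e0 ce]]; exists (- x); rewrite ?opprK //; split;
  rewrite /= ?opprK //.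
exists e => //; move/(countable_image (@GRing.opp R)): ce; apply: countable_sub => y [/= Vy hy].
by exists (- y); rewrite ?opprK //; split=> //=; lra.
Qed.

Definition condensation V : set R := V `\` (right_thin V `|` left_thin V).

(** The countable set [C] to be avoided may consist of the thin points, so that [y] is again a
    condensation point, or of the values of a countable family. *)
Lemma condensation_right V x e : has_lbound V -> has_ubound V -> condensation V x -> 0 < e ->
  forall C, countable C -> exists2 y, V y & x < y < x + e /\ ~ C y.
Proof.
move=> lV uV [Vx nx] e0 C cC; apply: contrapT => no; apply: nx; left; split=> //; exists e => //.
apply: countable_sub cC => y [Vy hy]; apply: contrapT => nC; apply: no; by exists y.
Qed.

Lemma condensation_left V x e : has_lbound V -> has_ubound V -> condensation V x -> 0 < e ->
  forall C, countable C -> exists2 y, V y & x - e < y < x /\ ~ C y.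
Proof.
move=> lV uV [Vx nx] e0 C cC; apply: contrapT => no; apply: nx; right; split=> //; exists e => //.
apply: countable_sub cC => y [Vy hy]; apply: contrapT => nC; apply: no; by exists y.
Qed.

Lemma countable_thin V : has_lbound V -> has_ubound V -> countable (right_thin V `|` left_thin V).
Proof.
by move=> lV uV; apply: countableU; [exact: countable_right_thin|exact: countable_left_thin].
Qed.

End Condensation.

Lemma sup_eq (R : realType) (E : set R) x : E !=set0 -> ubound E x ->
  (forall M, ubound E M -> x <= M) -> sup E = x.
Proof.
move=> E0 ux lx; apply/eqP; rewrite eq_le ge_sup //= lx // => y Ey.
by apply: ub_le_sup => //; exists x.
Qed.

Lemma inf_eq (R : realType) (E : set R) x : E !=set0 -> lbound E x ->
  (forall M, lbound E M -> M <= x) -> inf E = x.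
Proof.
move=> E0 ux lx; apply/eqP; rewrite eq_le lb_le_inf // andbT lx // => y Ey.
by apply: ge_inf => //; exists x.
Qed.

(** * Valuations in [V] of a countable linear preorder *)

Section GodelValuation.
Variables (R : realType) (V : set R) (X : Type) (le : X -> X -> Prop) (enum : nat -> X).
Hypothesis V_godel : godel_set V.
Hypothesis V_unc : ~ countable V.
Hypothesis le_refl : forall x, le x x.
Hypothesis le_trans : forall y x z, le x y -> le y z -> le x z.
Hypothesis le_total : forall x y, le x y \/ le y x.
Hypothesis enum_surj : forall x, exists n, enum n = x.
Variables (bot top : X).
Hypothesis bot_le : forall x, le bot x.
Hypothesis le_top : forall x, le x top.

(** The order embedding is altered at both ends to reach 0 and 1. Raising values to 1 loses
    strictness only at 1; lowering the bottom class to 0 could spoil infima equal to it, whence the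
    extra condition on [U]. *)
Lemma godel_valuation (x0 : X) : ~ le top x0 ->
  exists v : X -> R, [/\ (forall x, V (v x)), v bot = 0, v top = 1, v x0 < 1 &
   [/\ (forall x y, le x y -> v x <= v y),
       (forall x y, v x <= v y -> le x y \/ v y = 1),
       (forall U s, U !=set0 -> lub le U s -> sup (v @` U) = v s) &
       (forall U i, U !=set0 -> glb le U i -> (le i bot -> exists2 u, U u & le u bot) ->
          inf (v @` U) = v i)]].
Proof.
move=> tx0; have [_ V01 V0 V1] := V_godel.
have tb : ~ le top bot by move=> h; apply: tx0; apply: le_trans h (bot_le _).
have V01' x : V x -> 0 <= x <= 1 by move/V01; rewrite /= in_itv.
have lV : has_lbound V by exists 0 => x /V01' /andP[].
have uV : has_ubound V by exists 1 => x /V01' /andP[].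
have cT := countable_thin lV uV.
pose W := condensation V.
have WV x : W x -> V x by case.
have near_r l e : W l -> 0 < e -> exists2 m, W m & l < m < l + e.
  move=> Wl e0; have [m Vm [lm nm]] := condensation_right lV uV Wl e0 cT.
  by exists m.
have near_l l e : W l -> 0 < e -> exists2 m, W m & l - e < m < l.
  move=> Wl e0; have [m Vm [lm nm]] := condensation_left lV uV Wl e0 cT.
  by exists m.
(* Otherwise [V] would consist of 0 and the countably many thin points. *)
have [a Wa a0] : exists2 a, W a & 0 < a.
  apply: contrapT => no; apply: V_unc.
  apply: countable_sub (countableU (countable1 0) cT) => x Vx.
  have [->|x0'] := eqVneq x 0; [by left|right].
  apply: contrapT => nx; apply: no; exists x => //; rewrite lt_neqAle eq_sym x0'.
  by have /andP[] := V01' _ Vx.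
have [b Wb /andP[ab _]] := near_r _ _ Wa ltr01.
have [||h [hW hle hbot htop [hinf hsup]]] := order_embedding le_refl le_trans le_total enum_surj
    bot_le le_top tb (W := W) _ _ Wa Wb ab.
- move=> l r Wl Wr lr; have [|m Wm /andP[lm mr]] := near_r l ((r - l) / 2) Wl; first lra.
  by exists m => //; apply/andP; split=> //; lra.
- move=> l r Wl Wr lr; have [|m Wm /andP[lm mr]] := near_l r ((r - l) / 2) Wr; first lra.
  by exists m => //; apply/andP; split=> //; lra.
have lt_h x y : ~ le x y -> h y < h x by move=> nxy; rewrite ltNge; apply/negP => /hle.
have x0b : h x0 < b by rewrite -htop; apply: lt_h.
have h_ge x : a <= h x by rewrite -hbot; apply/hle.
(* The cut [w] lies in [V] between [h x0] and [b] and avoids the countable range of [h]; being above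
   [h x0], it keeps the value of [x0] below 1. *)
have [||w Vw [/andP[xw wb] nw]] := condensation_left lV uV Wb (e := b - h x0) _ (C := range h).
- by rewrite subr_gt0.
- apply: (@countable_sub _ _ (range (h \o enum))); last exact/countable_image/countableP.
  by move=> _ [x _ <-]; have [n <-] := enum_surj x; exists n.
have {}xw : h x0 < w by move: xw; rewrite subKr.
have hw x : h x != w by apply/eqP => e; apply: nw; exists x.
have aw : a < w by apply: le_lt_trans xw.
have w1 : w <= 1 by have /andP[] := V01' _ Vw.
(* Raising the values above w to 1 commutes with suprema because w itself is not a value. *)
pose v x := if `[< le x bot >] then 0 else if h x < w then h x else 1.
have vbot x : le x bot -> v x = 0 by move=> xb; rewrite /v asboolT.
have vlt x : ~ le x bot -> h x < w -> v x = h x by move=> xb hx; rewrite /v asboolF // hx.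
have vgt x : w < h x -> v x = 1.
  move=> hx; rewrite /v asboolF ?ltNge ?ltW // => /hle; rewrite hbot => h'.
  by move: (lt_trans aw hx); rewrite ltNge h'.
have vcases x : [\/ le x bot /\ v x = 0, [/\ ~ le x bot, h x < w & v x = h x]
   | [/\ ~ le x bot, w < h x & v x = 1]].
  have [xb|xb] := pselect (le x bot); first by apply: Or31; split=> //; exact: vbot.
  have := hw x; rewrite neq_lt => /orP[hx|hx]; [apply: Or32|apply: Or33]; split=> //.
    exact: vlt.
  exact: vgt.
have v_ge0 x : 0 <= v x.
  by case: (vcases x) => [[_ ->]|[_ _ ->]|[_ _ ->]] //;
    apply: Order.POrderTheory.le_trans (h_ge x); apply: ltW.
have v_le1 x : v x <= 1.
  case: (vcases x) => [[_ ->]|[_ hx ->]|[_ _ ->]] //.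
  by apply: Order.POrderTheory.le_trans w1; apply: ltW.
have v_mono x y : le x y -> v x <= v y.
  move=> xy; case: (vcases y) => [[yb _]|[yb hy ->]|[_ _ ->]]; last exact: v_le1.
    by rewrite vbot //; apply: le_trans yb.
  have hxy : h x <= h y by apply/hle.
  case: (vcases x) => [[_ ->]|[_ _ ->]|[_ hx _]] //; last by move: (lt_le_trans hx hxy);
    rewrite ltNge ltW.
  by apply: Order.POrderTheory.le_trans (h_ge y); apply: ltW.
exists v; split; last split=> //.
- move=> x; case: (vcases x) => [[_ ->]|[_ _ ->]|[_ _ ->]] //.
  exact/WV/hW.
- exact: vbot.
- by apply: vgt; rewrite htop.
- case: (vcases x0) => [[_ ->]|[_ hx ->]|[_ hx _]] //; last by move: (lt_trans xw hx);
    rewrite ltxx.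
  exact: lt_le_trans w1.
- move=> x y; case: (vcases y) => [[yb ->]|[yb hy ->]|[_ _ ->]]; last by right.
    case: (vcases x) => [[xb _] _|[_ _ ->]|[_ _ ->]]; first by left; apply: le_trans xb _.
      by move=> h'; have := lt_le_trans a0 (h_ge x); rewrite ltNge h'.
    by rewrite leNgt ltr01.
  case: (vcases x) => [[xb _] _|[_ _ ->]|[_ _ ->]]; first by left; apply: le_trans xb _.
    by move=> /hle; left.
  by move=> h'; have := lt_le_trans hy w1; rewrite ltNge h'.
- move=> U s [u0 Uu0] Us; have [ub lub] := Us; apply: sup_eq; first by exists (v u0), u0.
    by move=> _ [u Uu <-]; apply: v_mono; apply: ub.
  move=> M uM; have vM u : U u -> v u <= M by move=> Uu; apply: uM; exists u.
  have U0 : U !=set0 by exists u0.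
  have := hsup U s _ U0 Us; case: (vcases s) => [[_ ->]|[sb hs ->]|[_ hs ->]] Hs.
  + exact: Order.POrderTheory.le_trans (vM _ Uu0).
  (* Members of [U] in the bottom class have [v] equal to 0 but [h] equal to [a]; a member outside
     that class shows that [a <= M] nevertheless. *)
  + have [u1 [Uu1 ub1]] : exists u, U u /\ ~ le u bot.
      apply: contrapT => no; apply: sb; apply: lub => u Uu; apply: contrapT => ub'.
      by apply: no; exists u.
    have hM u : U u -> h u <= M.
      move=> Uu; have hus : h u <= h s by apply/hle/ub.
      case: (vcases u) => [[/hle ubb _]|[_ _ <-]|[_ hu _]]; last 2 first.
      * exact: vM.
      * by move: (lt_trans (lt_le_trans hu hus) hs); rewrite ltxx.
      apply: (Order.POrderTheory.le_trans ubb); rewrite hbot.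
      apply: Order.POrderTheory.le_trans (vM _ Uu1);
        case: (vcases u1) => [[]//|[_ _ ->]//|[_ _ ->]].
      exact: Order.POrderTheory.le_trans (ltW aw) w1.
    rewrite leNgt; apply/negP => Mh; have [|u Uu] := Hs (h s - M); first by rewrite subr_gt0.
    by rewrite subKr ltNge hM.
  (* Some member of [U] already exceeds the cut, so its value is 1. *)
  + have [|u Uu] := Hs (h s - w); first by rewrite subr_gt0.
    by rewrite subKr => /vgt <-; apply: vM.
- move=> U i [u0 Uu0] Ui botU; have [lb glb] := Ui; apply: inf_eq; first by exists (v u0), u0.
    by move=> _ [u Uu <-]; apply: v_mono; apply: lb.
  move=> M lM; have vM u : U u -> M <= v u by move=> Uu; apply: lM; exists u.
  have U0 : U !=set0 by exists u0.
  have := hinf U i _ U0 Ui; case: (vcases i) => [[ib ->]|[ib hi ->]|[_ _ ->]] Hi.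
  + by have [u Uu /vbot <-] := botU ib; apply: vM.
  + rewrite leNgt; apply/negP => hM.
    (* The minimum with [w] keeps [u] below the cut, where [v] and [h] agree. *)
    have [|u Uu] := Hi (Num.min M w - h i); first by rewrite subr_gt0 lt_min hM.
    rewrite addrC subrK lt_min => /andP[uM uw].
    have ub : ~ le u bot by move=> ub; apply: ib; apply: le_trans ub; apply: lb.
    by have := vM _ Uu; rewrite vlt // leNgt uM.
  + exact: Order.POrderTheory.le_trans (vM _ Uu0) (v_le1 u0).
Qed.

End GodelValuation.

(** * Soundness *)

Section Semantics.
Variables (R : realType) (L : signature) (V : set R).
Hypothesis V_godel : godel_set V.

Lemma godel01 x : V x -> 0 <= x <= 1.
Proof. by case: V_godel => _ V01 _ _ /V01; rewrite /= in_itv. Qed.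

Lemma godel_inf (E : set R) : E !=set0 -> E `<=` V -> V (inf E).
Proof.
case: V_godel => /closure_id VE _ _ _ E0 EV; rewrite VE.
have hE : has_inf E by split=> //; exists 0 => x /EV /godel01 /andP[].
move=> B /nbhs_ballP [e /= e0 eB]; have [x Ex xe] := inf_adherent e0 hE.
exists x; split; [exact: EV|apply: eB].
have xi : inf E <= x by apply: ge_inf => //; case: hE.
by rewrite /ball /= ltr_norml; lra.
Qed.

Lemma godel_sup (E : set R) : E !=set0 -> E `<=` V -> V (sup E).
Proof.
case: V_godel => /closure_id VE _ _ _ E0 EV; rewrite VE; apply: (closure_subset EV);
  apply: closure_sup => //.
by exists 1 => x /EV /godel01 /andP[].
Qed.

Section Families.
Variables (U : Type) (f : U -> R).
Hypothesis fV : forall u, V (f u).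

Lemma inf_range_le u : inf (range f) <= f u.
Proof. by apply: ge_inf; [exists 0 => _ [w _ <-]; have /andP[] := godel01 (fV w)|exists u]. Qed.

Lemma le_sup_range u : f u <= sup (range f).
Proof. by apply: ub_le_sup; [exists 1 => _ [w _ <-];
  have /andP[] := godel01 (fV w)|exists u]. Qed.

Lemma le_inf_range x : inhabited U -> (forall u, x <= f u) -> x <= inf (range f).
Proof. by move=> [u0] h; apply: lb_le_inf => [|_ [u _ <-]]; [exists (f u0), u0|exact: h]. Qed.

Lemma sup_range_le x : inhabited U -> (forall u, f u <= x) -> sup (range f) <= x.
Proof. by move=> [u0] h; apply: ge_sup => [|_ [u _ <-]]; [exists (f u0), u0|exact: h]. Qed.

Lemma godel_inf_range : inhabited U -> V (inf (range f)).
Proof. by move=> [u0]; apply: godel_inf => [|_ [u _ <-]//]; exists (f u0), u0. Qed.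

Lemma godel_sup_range : inhabited U -> V (sup (range f)).
Proof. by move=> [u0]; apply: godel_sup => [|_ [u _ <-]//]; exists (f u0), u0. Qed.

End Families.

Section Interpretation.
Variable I : @interpretation R L V.
Implicit Types (e : nat -> universe I) (A B C : formula L) (s t : term L).

Lemma formula_valV e A : V (formula_val e A).
Proof.
have [_ _ V0 V1] := V_godel; have inh := universe_inhabited I.
elim: A e => //= [p a|B IB C IC|B IB C IC|B IB C IC|y B IB|y B IB] e.
- exact: pred_valP.
- by rewrite /Num.min; case: ifP.
- by rewrite /Num.max; case: ifP.
- by case: ifP.
- exact: godel_inf_range.
- exact: godel_sup_range.
Qed.

Lemma formula_val01 e A : 0 <= formula_val e A <= 1.
Proof. exact/godel01/formula_valV. Qed.

Lemma term_val_ext e e' s : (forall x, occurs x s -> e x = e' x) -> term_val e s = term_val e' s.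
Proof.
elim: s => [y|f a IH] /= h; first by apply: h.
congr fun_val; apply/funext => i; apply: IH => x hx; apply: h.
by apply/existsP; exists i.
Qed.

Lemma formula_val_ext e e' A : (forall x, free_in x A -> e x = e' x) ->
  formula_val e A = formula_val e' A.
Proof.
elim: A e e' => //= [p a|B IB C IC|B IB C IC|B IB C IC|y B IB|y B IB] e e' h.
- congr pred_val; apply/funext => i; apply: term_val_ext => x hx; apply: h.
  by apply/existsP; exists i.
1-3: by rewrite (IB e e') ?(IC e e') // => x hx; apply: h; rewrite hx ?orbT.
- apply: (f_equal (fun f : universe I -> R => inf (range f))); apply/funext => u;
    apply: IB => x hx.
  by case: eqP => // /eqP xy; apply: h; rewrite xy.
- apply: (f_equal (fun f : universe I -> R => sup (range f))); apply/funext => u;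
    apply: IB => x hx.
  by case: eqP => // /eqP xy; apply: h; rewrite xy.
Qed.

Lemma formula_val_upd_fresh e x u A : ~~ free_in x A ->
  formula_val (upd x u e) A = formula_val e A.
Proof.
move=> h; apply: formula_val_ext => y hy; rewrite /upd; case: eqP => // yx.
by move: h; rewrite -yx hy.
Qed.

Lemma term_val_tsubst e x t s :
  term_val e (tsubst x t s) = term_val (upd x (term_val e t) e) s.
Proof.
elim: s => [y|f a IH] /=; first by rewrite /upd; case: eqP.
by congr fun_val; apply/funext.
Qed.

Lemma formula_val_fsubst e x t A : free_for t x A ->
  formula_val e (fsubst x t A) = formula_val (upd x (term_val e t) e) A.
Proof.
elim: A e => //= [p a|B IB C IC|B IB C IC|B IB C IC|y B IB|y B IB] e.
- by move=> _; congr pred_val; apply/funext => i; apply: term_val_tsubst.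
1-3: by case/andP => hB hC; rewrite IB ?IC.
all: move=> h; first [apply: (f_equal (fun f : universe I -> R => inf (range f)))|
  apply: (f_equal (fun f : universe I -> R => sup (range f)))]; apply/funext => u.
all: rewrite -/(upd y u e) -/(upd y u _); case: (eqVneq y x) => [->|yx]; first by rewrite upd_upd.
all: case/orP: h => [|/andP[yt hB]].
1,3: rewrite negb_and negbK eq_sym (negbTE yx) /= => xB.
1,2: by rewrite fsubst_notin // (updC _ _ _ yx) (@formula_val_upd_fresh _ x).
all: rewrite IB // (updC _ _ _ yx); congr formula_val; congr (upd _ _ _).
all: apply: term_val_ext => z hz; rewrite /upd; case: eqP => // zy.
all: by move: yt; rewrite -zy hz.
Qed.

Lemma term_val_tren e (r : nat -> nat) s : term_val e (tren r s) = term_val (e \o r) s.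
Proof. by elim: s => //= f a IH; congr fun_val; apply/funext. Qed.

Lemma formula_val_ren e (r : nat -> nat) A : injective r ->
  formula_val e (ren r A) = formula_val (e \o r) A.
Proof.
move=> r_inj; elim: A e => //= [p a|B IB C IC|B IB C IC|B IB C IC|y B IB|y B IB] e.
- by congr pred_val; apply/funext => i; apply: term_val_tren.
1-3: by rewrite IB IC.
- apply: (f_equal (fun f : universe I -> R => inf (range f))); apply/funext => u.
  rewrite IB; congr formula_val; apply/funext => z /=; by rewrite inj_eq.
- apply: (f_equal (fun f : universe I -> R => sup (range f))); apply/funext => u.
  rewrite IB; congr formula_val; apply/funext => z /=; by rewrite inj_eq.
Qed.

Lemma godel_imp_val (v x y : R) : v <= 1 ->
  (v <= (if x <= y then 1 else y)) = (Num.min v x <= y).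
Proof.
move=> v1; case: ifP => xy; first by rewrite v1 ge_min xy orbT.
by rewrite ge_min xy orbF.
Qed.

Lemma inf_truth_value_le (G : set (formula L)) B : G B -> inf_truth_value I G <= truth_value I B.
Proof.
move=> GB; apply: ge_inf; last by right; exists B.
by exists 0 => x [->//|[C _ <-]]; have /andP[] := formula_val01 (var_val I) C.
Qed.

Lemma inf_truth_value_le1 (G : set (formula L)) : inf_truth_value I G <= 1.
Proof.
apply: ge_inf; last by left.
by exists 0 => x [->//|[C _ <-]]; have /andP[] := formula_val01 (var_val I) C.
Qed.

(** * Validity of axioms and rules *)

Section Soundness.
Hypothesis isolated0 : isolated V 0.

(** Isolation of 0 gives a radius [e] such that every positive element of [V] is at least [e]. *)
Lemma inf_godel_gt0 (U : Type) (f : U -> R) : inhabited U -> (forall u, V (f u)) ->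
  (forall u, 0 < f u) -> 0 < inf (range f).
Proof.
move=> inh fV f0; have [_ [N /nbhs_ballP [e /= e0 eN] NV]] := isolated0.
apply: (lt_le_trans e0); apply: le_inf_range => // u; rewrite leNgt; apply/negP => fe.
have : (N `&` V) (f u).
  split=> //; apply: eN; by rewrite /ball /= sub0r normrN gtr0_norm.
by rewrite NV => /= f0'; have := f0 u; rewrite f0' ltxx.
Qed.

Lemma H0_axiom_valid A e : H0_axiom A -> formula_val e A = 1.
Proof.
have imp1 (x y : R) : x <= y -> (if x <= y then 1 else y) = 1 by move=> ->.
have inh := universe_inhabited I.
case=> [B|B|B C|B C|B C|B C|B|B x t h|B x t h|B C x h|B C|B x] /=.
- by apply: imp1; rewrite maxxx.
- by apply: imp1; rewrite minxx.
- by apply: imp1; rewrite le_max lexx.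
- by apply: imp1; rewrite ge_min lexx.
- by rewrite maxC lexx.
- by rewrite minC lexx.
- by have /andP[-> _] := formula_val01 e B.
- apply: imp1; rewrite formula_val_fsubst //.
  exact: (@inf_range_le _ (fun u => formula_val (upd x u e) B) (fun u => formula_valV _ _)).
- apply: imp1; rewrite formula_val_fsubst //.
  exact: (@le_sup_range _ (fun u => formula_val (upd x u e) B) (fun u => formula_valV _ _)).
- pose g u := Num.max (formula_val (upd x u e) C) (formula_val (upd x u e) B).
  have gV w : V (g w) := formula_valV (upd x w e) (Or C B).
  have gle u : inf (range g) <= Num.max (formula_val e C) (formula_val (upd x u e) B).
    by rewrite -(formula_val_upd_fresh e u h); exact: inf_range_le.
  apply: imp1; rewrite -/(inf (range g)) le_max leNgt.
  (* If the infimum exceeds the value of [C], each maximum in [gle] must be bounded through the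
     instance of [B]. *)
  case: ltP => //= hB; apply: le_inf_range => // u.
  by have := gle u; rewrite le_max leNgt hB.
- apply/eqP; rewrite eq_le ge_max le_max; have /andP[_ ->] := formula_val01 e (Imp B C).
  have /andP[_ ->] := formula_val01 e (Imp C B);
    case: (leP (formula_val e B) (formula_val e C)) => bc; first by rewrite lexx.
  by rewrite (ltW bc) lexx orbT.
(* Double negation sends 0 to 0 and positive values to 1. Either some instance is 0, and so is the
   left side, or all are positive and isolation makes their infimum positive. *)
- set f := fun u => formula_val _ B.
  have fV u : V (f u) by exact: formula_valV.
  have f01 u : 0 <= f u <= 1 by exact: godel01.
  set g := fun u => if _ then _ else _.
  have gE u : g u = if f u <= 0 then 0 else 1.
    by rewrite /g -/(f u); case: (f u <= 0); rewrite ?lexx ?ler10.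
  have gV w : V (g w) by have [_ _ V0 V1] := V_godel; rewrite gE; case: ifP.
  have [[u fu]|no] := pselect (exists u, f u <= 0).
    apply: imp1; apply: le_trans (inf_range_le gV u) _.
    by rewrite gE fu; case: ifP => // _; have [_ _ V0 V1] := V_godel; case: ifP.
  have pos : 0 < inf (range f).
    apply: inf_godel_gt0 => // u; rewrite ltNge; apply/negP => fu; by apply: no; exists u.
  by apply: imp1; rewrite (leNgt (inf (range f)) 0) pos /= lexx;
    have /andP[] := godel01 (godel_inf_range gV inh).
Qed.

Lemma H0_rule_valid v B : v <= 1 ->
  H0_rule [set C | forall e, v <= formula_val e C] B -> forall e, v <= formula_val e B.
Proof.
move=> v1 hB e; have m1 x : Num.min v x <= 1 by rewrite ge_min v1.
case: hB => /= [C D h1 h2|C D F h1 h2|C D F h|C D F h|C D F h|C D x hx h|C D x hx h] /=.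
- have := h2 e; rewrite /= godel_imp_val //; apply: le_trans.
  by rewrite le_min lexx h1.
- have := h2 e; have := h1 e; rewrite /= !godel_imp_val // => a1 a2.
  by apply: le_trans a2; rewrite le_min a1 ge_min lexx.
- have := h e; rewrite /= !godel_imp_val // => a1.
  rewrite !(ge_min, ge_max, le_max) lexx /=.
  by move: a1; rewrite ge_min => /orP[->|->]; rewrite ?orbT.
- have := h e; rewrite /= !godel_imp_val // => a1.
  by apply: le_trans a1; rewrite !le_min !ge_min !lexx ?orbT.
- have := h e; rewrite /= !godel_imp_val // => a1.
  by apply: le_trans a1; rewrite !le_min !ge_min !lexx ?orbT.
- rewrite godel_imp_val //; apply: le_inf_range; first exact: universe_inhabited.
  move=> u; have := h (upd x u e); rewrite /= godel_imp_val // (formula_val_upd_fresh e u hx);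
    exact.
- rewrite godel_imp_val //.
  set S := sup _; have [vC|vC] := leP v (formula_val e D); first by rewrite ge_min vC.
  rewrite ge_min; apply/orP; right; apply: sup_range_le; first exact: universe_inhabited.
  move=> u; have := h (upd x u e); rewrite /= godel_imp_val // (formula_val_upd_fresh e u hx).
  by rewrite ge_min leNgt vC.
Qed.

Lemma soundness (G : set (formula L)) A : G `<=` @closed_formula L ->
  H0_derives G A -> inf_truth_value I G <= truth_value I A.
Proof.
move=> Gc dA; have v1 := inf_truth_value_le1 G.
(* The quantifier rules require all assignments; for the hypotheses this is no loss because they are
   closed. *)
suff : forall e, inf_truth_value I G <= formula_val e A by apply.
apply: (H0_derives_ind (P := [set C | forall e, inf_truth_value I G <= formula_val e C])) dA.
- move=> B GB e; apply: le_trans (inf_truth_value_le GB) _.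
  by rewrite /truth_value (@formula_val_ext (var_val I) e) // => x; have /negP := Gc _ GB x.
- by move=> B hB e; rewrite H0_axiom_valid.
- by move=> B; exact: H0_rule_valid.
Qed.

End Soundness.
End Interpretation.
End Semantics.

(** * Prime Henkin theories *)

Section Enumeration.
Variable L : signature.

Let leaf : Type := (nat + fun_sym L + pred_sym L)%type.

Fixpoint term_code (s : term L) : GenTree.tree leaf :=
  match s with
  | Var n => GenTree.Leaf (inl (inl n))
  | App f a => GenTree.Node 0 (GenTree.Leaf (inl (inr f)) ::
                 [seq term_code (a i) | i <- enum 'I_(fun_arity f)])
  end.

Lemma term_code_inj : injective term_code.
Proof.
elim=> [n|f a IH] [m|g b] //=; first by case=> ->.
case=> fg; move: b; rewrite -fg => b /eq_in_map h.
by congr App; apply/funext => i; apply: IH; apply: h; rewrite mem_enum.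
Qed.

Fixpoint formula_code (A : formula L) : GenTree.tree leaf :=
  match A with
  | Bot => GenTree.Node 0 [::]
  | Atom p a => GenTree.Node 1 (GenTree.Leaf (inr p) ::
                  [seq term_code (a i) | i <- enum 'I_(pred_arity p)])
  | And B C => GenTree.Node 2 [:: formula_code B; formula_code C]
  | Or B C => GenTree.Node 3 [:: formula_code B; formula_code C]
  | Imp B C => GenTree.Node 4 [:: formula_code B; formula_code C]
  | All x B => GenTree.Node 5 [:: GenTree.Leaf (inl (inl x)); formula_code B]
  | Ex x B => GenTree.Node 6 [:: GenTree.Leaf (inl (inl x)); formula_code B]
  end.

Lemma formula_code_inj : injective formula_code.
Proof.
elim=> [|p a|B IB C IC|B IB C IC|B IB C IC|x B IB|x B IB]
  [|q b|B' C'|B' C'|B' C'|y B'|y B'] //=.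
- case=> pq; move: b; rewrite -pq => b /eq_in_map h.
  by congr Atom; apply/funext => i; apply: term_code_inj; apply: h; rewrite mem_enum.
1-3: by case=> /IB -> /IC ->.
all: by case=> -> /IB ->.
Qed.

(** Formulas are coded injectively by finite trees over a countable set of leaves; numbers that code
    no formula are sent to [Bot]. *)
Lemma formula_enum : exists en : nat -> formula L, forall A, exists n, en n = A.
Proof.
have code_inv n : exists A, forall B, pickle (formula_code B) = n -> B = A.
  have [[A hA]|no] := pselect (exists A, pickle (formula_code A) = n).
    exists A => B hB; apply: formula_code_inj; apply: (pcan_inj pickleK).
    by rewrite hB hA.
  by exists Bot => B hB; case: no; exists B.
have [en he] := choice code_inv; exists en => A.
by exists (pickle (formula_code A)); rewrite -(he _ A).
Qed.

End Enumeration.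

(** * Extension to a prime theory with witnesses *)

Section Henkin.
Variables (L : signature) (G : set (formula L)).
Implicit Types (A B C D E f t : formula L) (x a : nat).
Local Notation "A <<= B" := (leF G A B) (at level 70, no associativity).

Lemma fresh_even t f : exists a, [/\ ~~ odd a, ~~ var_in a t & ~~ var_in a f].
Proof.
have [N hN] := formula_bound t; have [M hM] := formula_bound f.
by exists (N + M).*2; rewrite odd_double; split=> //; [apply: hN|apply: hM]; lia.
Qed.

(** A rejected [Imp E (All x B)] has a fresh instance added to the disjunction [f] of rejected
    formulas; by [leF_all_fresh] this remains consistent with [t]. *)
Lemma henkin_all t f D : D <<= f -> ~ t <<= f -> exists f', [/\ f <<= f', ~ t <<= f' &
  forall E x B, D = Imp E (All x B) ->
    exists2 a, ~~ odd a & Imp E (fsubst x (Var a) B) <<= f'].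
Proof.
move=> Df ntf; have [[E [x [B DE]]]|no] := pselect (exists E x B, D = Imp E (All x B));
  last first.
  by exists f; split=> // [|E x B DE]; [exact: leF_refl|case: no; exists E, x, B].
have [a [ea at' afD]] := fresh_even t (Or f D).
move: afD; rewrite /= negb_or => /andP[af aD].
exists (Or f (Imp E (fsubst x (Var a) B))); split.
- exact: leF_orl.
- rewrite DE in aD; move/(leF_all_fresh at' af aD); rewrite -DE => h; apply: ntf.
  by apply: leF_trans h _; apply: leF_or; [exact: leF_refl|].
- by rewrite DE => E' x' B' [<- <- <-]; exists a => //; exact: leF_orr.
Qed.

Lemma henkin_ex t f D : D <<= f -> ~ t <<= f -> exists f', [/\ f <<= f', ~ t <<= f' &
  forall E x B, D = Imp (Ex x B) E ->
    exists2 a, ~~ odd a & Imp (fsubst x (Var a) B) E <<= f'].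
Proof.
move=> Df ntf; have [[E [x [B DE]]]|no] := pselect (exists E x B, D = Imp (Ex x B) E); last first.
  by exists f; split=> // [|E x B DE]; [exact: leF_refl|case: no; exists E, x, B].
have [a [ea at' afD]] := fresh_even t (Or f D).
move: afD; rewrite /= negb_or => /andP[af aD].
exists (Or f (Imp (fsubst x (Var a) B) E)); split.
- exact: leF_orl.
- rewrite DE in aD; move/(leF_ex_fresh at' af aD); rewrite -DE => h; apply: ntf.
  by apply: leF_trans h _; apply: leF_or; [exact: leF_refl|].
- by rewrite DE => E' x' B' [<- <- <-]; exists a => //; exact: leF_orr.
Qed.

Definition henkin_rejects f D : Prop :=
  [/\ D <<= f,
      forall E x B, D = Imp E (All x B) ->
        exists2 a, ~~ odd a & Imp E (fsubst x (Var a) B) <<= f &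
      forall E x B, D = Imp (Ex x B) E ->
        exists2 a, ~~ odd a & Imp (fsubst x (Var a) B) E <<= f].

(** Accept [D] if that is consistent; otherwise [leF_cut] allows rejecting it. Consistency of [s] is
    assumed under the existential so that choice gives a total step function. *)
Lemma henkin_step (s : formula L * formula L) D : exists s', ~ s.1 <<= s.2 ->
  [/\ s'.1 <<= s.1, s.2 <<= s'.2, ~ s'.1 <<= s'.2 & s'.1 <<= D \/ henkin_rejects s'.2 D].
Proof.
case: s => t f /=; have [h|h] := pselect (And t D <<= f); last first.
  exists (And t D, f) => _ /=.
  by split=> //; [exact: leF_andl|exact: leF_refl|left; exact: leF_andr].
have [tf|ntf] := pselect (t <<= f); first by exists (t, f).
have ntf1 : ~ t <<= Or f D by move=> /(leF_cut h).
(* Both witness steps are taken in succession, since an implication may have an existential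
   antecedent and a universal consequent. *)
have [f2 [ff2 ntf2 h2]] := henkin_all (leF_orr G f D) ntf1.
have [f3 [ff3 ntf3 h3]] := henkin_ex (leF_trans (leF_orr G f D) ff2) ntf2.
exists (t, f3) => _ /=; split=> //; first exact: leF_refl.
  exact: leF_trans (leF_orl _ _ _) (leF_trans ff2 ff3).
right; split=> //; first exact: leF_trans (leF_orr _ _ _) (leF_trans ff2 ff3).
by move=> E x B /h2 [a ea ha]; exists a => //; apply: leF_trans ha ff3.
Qed.

(** Witnesses are even variables, so that they are never captured in formulas whose bound variables
    are odd. *)
Record henkin_theory (T : set (formula L)) : Prop := HenkinTheory {
  henkin_derives : forall D, H0_derives G D -> T D;
  henkin_mp : forall D E, T D -> T (Imp D E) -> T E;
  henkin_prime : forall D E, T (Or D E) -> T D \/ T E;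
  henkin_all_witness : forall E x B, ~ T (Imp E (All x B)) ->
    exists2 a, ~~ odd a & ~ T (Imp E (fsubst x (Var a) B));
  henkin_ex_witness : forall E x B, ~ T (Imp (Ex x B) E) ->
    exists2 a, ~~ odd a & ~ T (Imp (fsubst x (Var a) B) E) }.

Lemma henkin_exists A : ~ H0_derives G A -> exists2 T, henkin_theory T & ~ T A.
Proof.
move=> nA; have [en enP] := formula_enum L.
have [next hnext] :=
  choice (fun sD : (formula L * formula L) * formula L => henkin_step sD.1 sD.2).
(* The components of s n are the conjunction of the formulas accepted and the disjunction
   of the formulas rejected up to stage n. *)
pose s := fix s n := if n is k.+1 then next (s k, en k) else (Top L, A).
have cons n : ~ (s n).1 <<= (s n).2.
  elim: n => [|n IH]; first by move/top_leF.
  by have [] := hnext (s n, en n) IH.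
have step n : [/\ (s n.+1).1 <<= (s n).1, (s n).2 <<= (s n.+1).2 &
    (s n.+1).1 <<= en n \/ henkin_rejects (s n.+1).2 (en n)].
  by have [] := hnext (s n, en n) (cons n).
have t_mono n k : (s (n + k)%N).1 <<= (s n).1.
  elim: k => [|k IH]; first by rewrite addn0; exact: leF_refl.
  by rewrite addnS; have [h _ _] := step (n + k)%N; exact: leF_trans h IH.
have f_mono n k : (s n).2 <<= (s (n + k)%N).2.
  elim: k => [|k IH]; first by rewrite addn0; exact: leF_refl.
  by rewrite addnS; have [_ h _] := step (n + k)%N; exact: leF_trans IH h.
(* Accepted formulas strengthen and rejected ones weaken with the stage, so both are compared at
   stage [n + m]. *)
have cons2 n m : ~ (s n).1 <<= (s m).2.
  move=> h; apply: (cons (n + m)%N); apply: leF_trans (t_mono _ _) _; apply: leF_trans h _.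
  by rewrite addnC.
pose T : set (formula L) := [set D | exists n, (s n).1 <<= D].
have nT D n : D <<= (s n).2 -> ~ T D by move=> h [m /leF_trans /(_ h)]; exact: cons2.
have dec D : T D \/ exists n, henkin_rejects (s n).2 D.
  have [n <-] := enP D; have [_ _ [h|h]] := step n; [left|right]; by exists n.+1.
have Tle D E : T D -> D <<= E -> T E by move=> [n h] h'; exists n; apply: leF_trans h'.
exists T; last by apply: (nT _ 0%N); exact: leF_refl.
split.
- by move=> D hD; exists 0%N; apply: derives_leF.
- move=> D E [n h1] [m h2]; exists (n + m)%N; apply: leF_trans (leF_mp G D E).
  apply: leF_and; first by rewrite addnC; apply: leF_trans (t_mono _ _) h2.
  exact: leF_trans (t_mono _ _) h1.
- move=> D E TDE; have [|[n [hD _ _]]] := dec D; first by left.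
  have [|[m [hE _ _]]] := dec E; first by right.
  case: (@nT (Or D E) (n + m)%N _ TDE); apply: leF_or; first exact: leF_trans hD (f_mono _ _).
  by rewrite addnC; exact: leF_trans hE (f_mono _ _).
- move=> E x B nTD; have [//|[n [_ h _]]] := dec (Imp E (All x B)).
  by have [a ea /nT ha] := h _ _ _ erefl; exists a.
- move=> E x B nTD; have [//|[n [_ _ h]]] := dec (Imp (Ex x B) E).
  by have [a ea /nT ha] := h _ _ _ erefl; exists a.
Qed.

End Henkin.

(** * The linear preorder of a prime Henkin theory *)

Section HenkinOrder.
Variables (L : signature) (G T : set (formula L)).
Hypothesis hT : henkin_theory G T.
Implicit Types (A B C D E : formula L) (x a : nat).

Definition leT D E : Prop := T (Imp D E).

Lemma leT_leF D E : leF G D E -> leT D E.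
Proof. exact: henkin_derives. Qed.

Lemma henkin_le D E : leF G D E -> T D -> T E.
Proof. by move=> /leT_leF h TD; apply: (henkin_mp hT) h. Qed.

Lemma henkin_and D E : T D -> T E -> T (And D E).
Proof.
move=> TD TE; apply: (henkin_mp hT) (TE) _; apply: (henkin_mp hT) (TD) _.
by apply: (henkin_derives hT); apply/leF_impP/leF_refl.
Qed.

Lemma leT_refl D : leT D D. Proof. exact/leT_leF/leF_refl. Qed.

Lemma leT_trans E D C : leT D E -> leT E C -> leT D C.
Proof.
move=> h1 h2; apply: henkin_le (henkin_and h1 h2); apply/leF_impP.
apply: leF_trans (leF_mp G E C); apply: leF_and.
  exact: leF_trans (leF_andl _ _ _) (leF_andr _ _ _).
apply: leF_trans (leF_mp G D E); apply: leF_and; last exact: leF_andr.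
exact: leF_trans (leF_andl _ _ _) (leF_andl _ _ _).
Qed.

Lemma leT_total D E : leT D E \/ leT E D.
Proof. by apply: (henkin_prime hT); apply: (henkin_derives hT); apply/derives_ax/LIN. Qed.

Lemma leT_and D E C : leT C D -> leT C E -> leT C (And D E).
Proof.
move=> h1 h2; apply: henkin_le (henkin_and h1 h2); apply/leF_impP; apply: leF_and.
  apply: leF_trans (leF_mp G C D); apply: leF_and; last exact: leF_andr.
  exact: leF_trans (leF_andl _ _ _) (leF_andl _ _ _).
apply: leF_trans (leF_mp G C E); apply: leF_and; last exact: leF_andr.
exact: leF_trans (leF_andl _ _ _) (leF_andr _ _ _).
Qed.

Lemma leT_top D : leT (Top L) D <-> T D.
Proof.
split=> [h|]; last by apply: henkin_le; apply/leF_impP/leF_andl.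
by apply: (henkin_mp hT) h; apply: (henkin_derives hT); exact: leF_refl.
Qed.

(** Compare [Imp D E] with [D]: the smaller of the two lies below both, hence below [E] by modus
    ponens. If that is [D], the hypothesis is contradicted. *)
Lemma leT_imp D E : ~ leT D E -> leT (Imp D E) E.
Proof.
move=> nDE; have [h|h] := leT_total (Imp D E) D.
  by apply: leT_trans (leT_leF (leF_mp G D E)); apply: leT_and => //; exact: leT_refl.
by case: nDE; apply: leT_trans (leT_leF (leF_mp G D E)); apply: leT_and => //; exact: leT_refl.
Qed.

(* The only use of ISO0 in the completeness proof. *)
Lemma leT_all_bot x B : leT (All x B) Bot -> exists2 a, ~~ odd a & leT (fsubst x (Var a) B) Bot.
Proof.
move=> h; apply: contrapT => no.
(* If no even instance is in the bottom class, all their double negations are in [T]. The witness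
   property then gives the universal formula, and ISO0 makes [T] contain [Bot]. *)
have nn a : ~~ odd a -> T (Neg (Neg (fsubst x (Var a) B))).
  by move=> ea; apply: leT_imp => h'; apply: no; exists a.
have : leT (Top L) (All x (Neg (Neg B))).
  apply: contrapT => /(henkin_all_witness hT) [a ea]; apply.
  by apply/leT_top; apply: nn.
move/leT_top => h1; have : T (Neg (Neg (All x B))).
  by apply: henkin_le h1; apply/derives_ax/ISO0.
move=> h2; have TB : T Bot := henkin_mp hT h h2.
by apply: no; exists 0%N => //; apply: henkin_le TB; exact: leF_bot.
Qed.

End HenkinOrder.

(** * The canonical model *)

Section Completeness.
Variable L : signature.
Implicit Types (A B C D : formula L) (s t : term L) (x y a : nat).

(** Doubling makes all variables even, and every even variable is the double of a variable, so
    Henkin witnesses are among the doubled terms. *)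
Definition double_term : term L -> term L := tren double.

Lemma odd_notin_double y s : odd y -> ~~ occurs y (double_term s).
Proof.
move=> oy; elim: s => [n|f b IH] /=; last exact/existsPn.
by apply: contraL oy => /eqP ->; rewrite odd_double.
Qed.

Lemma free_for_double x s B : (forall y, binds y B -> odd y) -> free_for (double_term s) x B.
Proof. by move=> h; apply: free_for_binds => y /h; exact: odd_notin_double. Qed.

Lemma double_term_var a : ~~ odd a -> double_term (Var a./2) = Var a.
Proof. by move=> ea; rewrite /double_term /= halfK (negbTE ea) subn0. Qed.

Section CanonicalModel.
Variables (R : realType) (V : set R) (G T : set (formula L)) (v : formula L -> R).
Hypothesis hT : henkin_theory G T.
Hypothesis vV : forall B, V (v B).
Hypothesis v_bot : v Bot = 0.
Hypothesis v_top : v (Top L) = 1.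
Hypothesis v_mono : forall B C, leT T B C -> v B <= v C.
Hypothesis v_strict : forall B C, v B <= v C -> leT T B C \/ v C = 1.
Hypothesis v_sup : forall U D, U !=set0 -> lub (leT T) U D -> sup (v @` U) = v D.
Hypothesis v_inf : forall U D, U !=set0 -> glb (leT T) U D ->
  (leT T D Bot -> exists2 u, U u & leT T u Bot) -> inf (v @` U) = v D.

Lemma v_derives B : T B -> v B = 1.
Proof.
by move=> /(leT_top hT) h; apply/eqP; rewrite eq_le -{2}v_top v_mono // andbT -v_top v_mono //;
  apply: (leT_leF hT); exact: leF_top.
Qed.

Lemma v_and B C : v (And B C) = Num.min (v B) (v C).
Proof.
have h1 := leT_leF hT (leF_andl G B C); have h2 := leT_leF hT (leF_andr G B C).
apply/eqP; rewrite eq_le le_min !v_mono //=.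
have [h|h] := leT_total hT B C; rewrite ge_min.
  by rewrite (v_mono (leT_and hT (leT_refl hT _) h)).
by rewrite (v_mono (leT_and hT h (leT_refl hT _))) orbT.
Qed.

Lemma v_or B C : v (Or B C) = Num.max (v B) (v C).
Proof.
have h1 := leT_leF hT (leF_orl G B C); have h2 := leT_leF hT (leF_orr G B C).
apply/eqP; rewrite eq_le ge_max !v_mono //= andbT le_max.
have leor D E : leT T D E -> leT T (Or D E) E.
  move=> h; apply: (henkin_le hT) h; apply/leF_impP.
  apply: leF_trans (leF_andC _ _ _) _; apply/leF_impP; apply: leF_or; apply/leF_impP.
    by apply: leF_trans (leF_andC _ _ _) _; exact: leF_mp.
  exact: leF_andl.
have [h|h] := leT_total hT B C; first by rewrite (v_mono (leor _ _ h)) orbT.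
by rewrite (v_mono (leT_trans hT (leT_leF hT (leF_orC _ _ _)) (leor _ _ h))).
Qed.

Lemma v_imp B C : v (Imp B C) = if v B <= v C then 1 else v C.
Proof.
have [h|h] := pselect (leT T B C); first by rewrite v_mono // v_derives.
have e : v (Imp B C) = v C.
  apply/eqP; rewrite eq_le (v_mono (leT_imp hT h)) v_mono //.
  by apply: (leT_leF hT); apply/leF_impP; exact: leF_andl.
(* Strictness of [v] can fail only where [v C] is 1, and there both branches agree. *)
by rewrite e; case: ifP => // /v_strict[|->].
Qed.

(** By the witness property [All x B] is the greatest lower bound of its instances by doubled terms;
    [leT_all_bot] supplies the condition for the bottom class. *)
Lemma v_all x B : (forall y, binds y B -> odd y) ->
  inf (range (fun s => v (fsubst x (double_term s) B))) = v (All x B).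
Proof.
move=> oB; rewrite -(image_comp (fun s => fsubst x (double_term s) B) v).
apply: v_inf; first by exists (fsubst x (double_term (Var 0%N)) B), (Var 0%N).
- split=> [_ [s _ <-]|E hE].
    by apply: (leT_leF hT); apply: leF_all_elim; exact: free_for_double.
  apply: contrapT => /(henkin_all_witness hT) [a ea]; apply; apply: hE.
  by exists (Var a./2); rewrite ?double_term_var.
- move/(leT_all_bot hT) => [a ea ha]; exists (fsubst x (Var a) B) => //.
  by exists (Var a./2); rewrite ?double_term_var.
Qed.

Lemma v_ex x B : (forall y, binds y B -> odd y) ->
  sup (range (fun s => v (fsubst x (double_term s) B))) = v (Ex x B).
Proof.
move=> oB; rewrite -(image_comp (fun s => fsubst x (double_term s) B) v).
apply: v_sup; first by exists (fsubst x (double_term (Var 0%N)) B), (Var 0%N).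
split=> [_ [s _ <-]|E hE].
  by apply: (leT_leF hT); apply: leF_ex_intro; exact: free_for_double.
apply: contrapT => /(henkin_ex_witness hT) [a ea]; apply; apply: hE.
by exists (Var a./2); rewrite ?double_term_var.
Qed.

(* Bound variables of the evaluated formulas are odd and the variables of doubled terms are
   even, so substituting doubled terms never captures. *)
Definition canonical_model : interpretation L V :=
  @Interpretation R L V (term L) (inhabits (Var 0%N))
    (fun p b => v (Atom (fun i => double_term (b i)))) (fun p b => vV _)
    (fun f b => App b) Var.

Lemma canonical_term_val (e : nat -> term L) s :
  double_term (@term_val R L V canonical_model e s) = tsub (double_term \o e) s.
Proof. by elim: s => //= f b IH; congr App; apply/funext. Qed.

(** The truth lemma. At a quantifier, substituting a doubled term for the bound variable after
    [fsub] amounts to updating the assignment. *)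
Lemma canonical_val (e : nat -> term L) B : (forall y, binds y B -> odd y) ->
  @formula_val R L V canonical_model e B = v (fsub (double_term \o e) B).
Proof.
have double_upd y u (e' : nat -> term L) :
    double_term \o upd y u e' = upd y (double_term u) (double_term \o e').
  by apply/funext => z /=; rewrite /upd; case: eqP.
elim: B e => [|p b|B IB C IC|B IB C IC|B IB C IC|y B IB|y B IB] e h /=.
- by rewrite v_bot.
- congr v; congr Atom; apply/funext => i; exact: canonical_term_val.
1-3: have hB z : binds z B -> odd z by move=> hz; apply: h; rewrite /= hz.
1-3: have hC z : binds z C -> odd z by move=> hz; apply: h; rewrite /= hz orbT.
1-3: by rewrite IB // IC // ?v_and ?v_or ?v_imp.
all: have hB z : binds z B -> odd z by move=> hz; apply: h; rewrite /= hz orbT.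
all: have oy : odd y by apply: h; rewrite /= eqxx.
all: have notin z : z != y -> ~~ occurs y ((double_term \o e) z) by move=> _;
  exact: odd_notin_double.
all: have hB' z : binds z (fsub (upd y (Var y) (double_term \o e)) B) ->
  odd z by rewrite binds_fsub; exact: hB.
- rewrite -(v_all _ hB'); apply: (f_equal (fun f : term L -> R => inf (range f))).
  by apply/funext => u; rewrite -/(upd y u e) IB // double_upd fsubst_fsub.
- rewrite -(v_ex _ hB'); apply: (f_equal (fun f : term L -> R => sup (range f))).
  by apply/funext => u; rewrite -/(upd y u e) IB // double_upd fsubst_fsub.
Qed.

End CanonicalModel.

(** * From the canonical model to completeness *)

Lemma tsub_id (e : nat -> term L) s : (forall x, occurs x s -> e x = Var x) -> tsub e s = s.
Proof.
elim: s => [n|f b IH] h /=; first by apply: h => /=.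
congr App; apply/funext => i; apply: IH => x hx; apply: h; apply/existsP; by exists i.
Qed.

Lemma fsub_id (e : nat -> term L) A : (forall x, free_in x A -> e x = Var x) -> fsub e A = A.
Proof.
elim: A e => [|p b|B IB C IC|B IB C IC|B IB C IC|y B IB|y B IB] e h //=.
- congr Atom; apply/funext => i; apply: tsub_id => x hx; apply: h; apply/existsP; by exists i.
1-3: by rewrite IB ?IC // => x hx; apply: h; rewrite /= hx ?orbT.
all: rewrite IB // => x hx; rewrite /upd; case: eqP => [->//|/eqP xy].
all: by apply: h; rewrite /= xy.
Qed.

Lemma closed_ren (r : nat -> nat) A : injective r -> closed_formula A -> closed_formula (ren r A).
Proof.
move=> r_inj cA y; apply/negP => hy.
have occ s : occurs y (tren r s) -> exists x, y = r x.
  by elim: s => [n /eqP|f b IH /existsP [i /IH]]; first by exists n.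
have [x yx] : exists x, y = r x.
  elim: A {cA} hy => [//|p b /existsP [i /occ]//|B IB C IC|B IB C IC|B IB C IC|z B IB|z B IB] /=.
  1-3: by case/orP.
  1-2: by case/andP => _ /IB.
by move: hy; rewrite yx free_in_ren // (negbTE (cA x)).
Qed.

Lemma closed_completeness (R : realType) (V : set R) (G : set (formula L)) A :
  godel_set V -> ~ countable V -> G `<=` @closed_formula L -> closed_formula A ->
  entails V G A -> H0_derives G A.
Proof.
move=> gV uV cG cA ent; apply: contrapT => nGA.
have odd_ren_inj : injective odd_ren by move=> m n; rewrite /odd_ren; lia.
pose rG := ren odd_ren @` G; pose rA := ren odd_ren A.
have nrA : ~ H0_derives rG rA by move=> /derives_unren.
have [T hT nTA] := henkin_exists nrA.
have [en enP] := formula_enum L.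
have ntop : ~ leT T (Top L) rA by move/(leT_top hT).
have [v [vV v0 v1 vA [vm vs vsup vinf]]] := godel_valuation gV uV (leT_refl hT) (leT_trans hT)
  (leT_total hT) enP (fun D => leT_leF hT (leF_bot rG D)) (fun D => leT_leF hT (leF_top rG D))
    ntop.
pose I := canonical_model vV.
have val B : closed_formula B -> truth_value I B = v (ren odd_ren B).
  move=> cB; have cr := closed_ren odd_ren_inj cB.
  (* The truth lemma yields a substitution instance by doubled variables, which is the formula
     itself because it is closed. *)
  rewrite -(@fsub_id (double_term \o (fun n => Var n)) (ren odd_ren B)); last first.
    by move=> x; rewrite (negbTE (cr x)).
  rewrite -(canonical_val hT vV) //; last by move=> y /binds_ren [z ->];
    rewrite /odd_ren /= odd_double.
  rewrite formula_val_ren //; apply: formula_val_ext => x; by rewrite (negbTE (cB x)).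
(* In the canonical model all hypotheses have value 1, whereas the value of [A] is below 1. *)
have := ent I; rewrite val // leNgt => /negP; apply.
apply: (lt_le_trans vA); apply: lb_le_inf; first by exists 1; left.
move=> x [->//|[B GB <-]]; rewrite val; last exact: cG.
rewrite (v_derives hT v1 vm) //; apply: (henkin_derives hT); apply: derives_hyp.
by exists B.
Qed.

(** Changing the value of [x] in the interpretation leaves the closed hypotheses alone, so the bound
    holds for every instance. *)
Lemma entails_all (R : realType) (V : set R) (G : set (formula L)) x A :
  godel_set V -> G `<=` @closed_formula L -> entails V G A -> entails V G (All x A).
Proof.
move=> gV cG ent I; apply: (le_inf_range (U := universe I)) => [|u];
  first exact: universe_inhabited.
have := ent (Interpretation (universe_inhabited I) (@pred_valP _ _ _ I) (@fun_val _ _ _ I)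
  (upd x u (var_val I))).
apply: le_trans; rewrite /inf_truth_value; set S := _ `|` _; set S' := _ `|` _.
suff -> : S = S' by [].
congr (_ `|` _); apply: eq_imagel => B /cG cB.
by apply: (@formula_val_ext R L V I) => y; rewrite (negbTE (cB y)).
Qed.

Lemma completeness (R : realType) (V : set R) (G : set (formula L)) A :
  godel_set V -> ~ countable V -> G `<=` @closed_formula L ->
  entails V G A -> H0_derives G A.
Proof.
move=> gV uV cG ent.
have [N hN] := formula_bound A.
(* Prefixing quantifiers over all variables below [N] closes [A]; entailment passes to the closure,
   and instantiation later strips the prefix. *)
pose cl := foldr (fun x B => All x B) A.
have freeE xs x : free_in x (cl xs) = (x \notin xs) && free_in x A.
  by elim: xs => //= y xs ->; rewrite inE negb_or andbA.
have clA : closed_formula (cl (iota 0 N)).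
  move=> x; rewrite freeE mem_iota /= add0n -leqNgt negb_and.
  by case: leqP => //= /hN; apply: contra; exact: free_var_in.
have entcl xs : entails V G (cl xs) by elim: xs => //= x xs; exact: entails_all.
have := closed_completeness gV uV cG clA (entcl _).
by elim: (iota 0 N) => //= x xs IH h; apply: IH; apply: derives_mp h _; exact: leF_all_id.
Qed.

End Completeness.

Unset Implicit Arguments.

Theorem theorem43 (R : realType) (L : signature) (V : set R)
    (Gamma : set (formula L)) (A : formula L) :
  godel_set V -> ~ countable V -> isolated V 0 ->
  Gamma `<=` @closed_formula L ->
  (entails V Gamma A <-> H0_derives Gamma A).
Proof.
move=> gV uV i0 cG; split; first exact: completeness.
by move=> dA I; exact: soundness.
Qed.
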